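(* Let $A$ be a Noetherian $\mathbb{Z}^{n}$-graded domain such that $A_{\mathbf 0}$ is a field. (1) There exist only finitely many non-zero ray ideals of $A$. (2) For each non-zero ray ideal $J$ of $A$, there exists a unique maximal ray ideal cone $\sigma_J$ of the ray ideal $J$ (i.e. maximal among the ray ideal cones of $A$ whose ray ideal is $J$). Furthermore, $\sigma_J$ is a rational polyhedral cone. For any $\mathbf a\in\mathbb{Q}^n\setminus\sigma_J$, $J_{\mathbf a}(A)$ does not coincide with $J$. (3) Suppose that a rational polyhedral cone $\sigma$ is a ray ideal cone of $A$. Then any face of $\sigma$ is also a ray ideal cone of $A$. (4) Let $J_1$ and $J_2$ be non-zero ray ideals of $A$. Then $J_1$ contains $J_2$ if and only if $\sigma_{J_1}$ is a face of $\sigma_{J_2}$. (5) Assume that $A_{\mathbf 0}\setminus\{0\}$ coincides with the set of units in $A$. Then $$\{\sigma_J\mid J\text{ is a non-zero ray ideal of }A\}$$ forms a fan.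
   Context: Rings are commutative with $1$. A $\mathbb{Z}^n$-graded ring is a ring $A=\bigoplus_{\mathbf a\in\mathbb{Z}^n}A_{\mathbf a}$ with additive subgroups $A_{\mathbf a}$ such that $A_{\mathbf a}A_{\mathbf b}\subset A_{\mathbf a+\mathbf b}$; a $\mathbb{Z}^n$-graded domain is one that is an integral domain. A cone in $\mathbb{R}^n$ is a subset $\sigma$ closed under addition and with $\mathbb{R}_{\ge0}\mathbf a\subset\sigma$ for all $\mathbf a\in\sigma$; ${\rm rel.int}(\sigma)$ is its relative interior (interior in $\sigma-\sigma$). A rational polyhedral cone is a cone spanned by finitely many elements of $\mathbb{Q}^n$; a cone is regarded as a face of itself. For $\mathbf a\in\mathbb{Q}^n$, $I_{\mathbf a}(A)$ is the ideal of $A$ generated by $\bigcup_{\mathbf b\in\mathbb{R}_{>0}\mathbf a\cap\mathbb{Z}^n}A_{\mathbf b}$, and $J_{\mathbf a}(A)=\sqrt{I_{\mathbf a}(A)}$; the ideals $J_{\mathbf a}(A)$, $\mathbf a\in\mathbb{Q}^n$, are called the ray ideals of $A$. A ray ideal cone of $A$ is a cone $\sigma$ such that $\sigma-\sigma$ is an $\mathbb{R}$-subspace spanned by finitely many elements of $\mathbb{Q}^n$ and $J_{\mathbf a}(A)=J_{\mathbf b}(A)\ne0$ for all $\mathbf a,\mathbf b\in{\rm rel.int}(\sigma)\cap\mathbb{Q}^n$; this common ideal is called the ray ideal of $\sigma$. A set $\Delta$ of strongly convex rational polyhedral cones (cones containing no line) is a fan if every face of a cone in $\Delta$ is in $\Delta$,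 and for $\sigma_1,\sigma_2\in\Delta$ the intersection $\sigma_1\cap\sigma_2$ is a face of both $\sigma_1$ and $\sigma_2$. *)

(* Defs.v *)
From mathcomp Require Export all_boot all_order all_algebra.
From mathcomp Require Export all_classical all_reals all_analysis.

Set Implicit Arguments.
Unset Strict Implicit.
Unset Printing Implicit Defensive.

Import Order.TTheory GRing.Theory Num.Theory.
Import numFieldNormedType.Exports.

Local Open Scope classical_set_scope.
Local Open Scope ring_scope.

Section Ideals.
Variable A : comNzRingType.

Definition is_ideal (I : set A) : Prop :=
  [/\ I 0, forall x y, I x -> I y -> I (x + y)
    & forall c x, I x -> I (c * x)].

Definition ideal_gen (S : set A) : set A := smallest is_ideal S.

Definition radical (I : set A) : set A := [set x | exists k : nat, I (x ^+ k)].

Definition noetherian : Prop :=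
  forall I : set A, is_ideal I -> exists s : seq A, I = ideal_gen [set` s].

(* [K] is meant to be already closed under addition, opposite and product. *)
Definition is_field_subring (K : set A) : Prop :=
  K 1 /\ forall x, K x -> x <> 0 -> exists2 y, K y & x * y = 1.

Variable n : nat.

(* Internal direct sum decomposition of [A] indexed by Z^n. The finiteness of
   the support is required explicitly because the sum over an infinite support
   is 0 by convention. *)
Record is_grading (A_ : 'rV[int]_n -> set A) : Prop := IsGrading {
  grading0 : forall a, A_ a 0;
  gradingB : forall a x y, A_ a x -> A_ a y -> A_ a (x - y);
  gradingM : forall a b x y, A_ a x -> A_ b y -> A_ (a + b) (x * y);
  grading_direct : forall x : A, exists! f : 'rV[int]_n -> A,
    [/\ forall a, A_ a (f a), finite_set [set a | f a != 0]
      & x = \sum_(a \in [set: 'rV[int]_n]) f a]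
}.

End Ideals.

Section Cones.
Variables (R : realType) (n : nat).
Implicit Types (s t : set 'rV[R]_n) (D : set (set 'rV[R]_n)).

Definition ratv (a : 'rV[rat]_n) : 'rV[R]_n := map_mx ratr a.
Definition intv (b : 'rV[int]_n) : 'rV[R]_n := map_mx intr b.

Definition is_cone s : Prop :=
  (forall x y, s x -> s y -> s (x + y)) /\
  (forall (c : R) x, 0 <= c -> s x -> s (c *: x)).

Definition diffset s : set 'rV[R]_n := [set x - y | x in s & y in s].

Definition relint s : set 'rV[R]_n :=
  [set x | s x /\ \forall y \near within (diffset s) (nbhs x), s y].

Definition rational_span s : Prop :=
  exists g : seq 'rV[rat]_n, s = [set x | x \in <<map ratv g>>%VS].

Definition rational_polyhedral s : Prop :=
  exists (m : nat) (g : 'I_m -> 'rV[rat]_n),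
    s = [set x | exists c : 'I_m -> R,
           (forall i, 0 <= c i) /\ x = \sum_(i < m) c i *: ratv (g i)].

(* Faces are cut out by supporting hyperplanes; [u = 0] gives [s] itself. *)
Definition is_face t s : Prop :=
  exists u : {scalar 'rV[R]_n},
    (forall x, s x -> 0 <= u x) /\ t = [set x | s x /\ u x = 0].

Definition contains_line s : Prop :=
  exists p v : 'rV[R]_n, v <> 0 /\ forall c : R, s (p + c *: v).

Definition is_fan D : Prop :=
  [/\ forall s, D s -> rational_polyhedral s /\ ~ contains_line s,
      forall s t, D s -> is_face t s -> D t
    & forall s1 s2, D s1 -> D s2 ->
        is_face (s1 `&` s2) s1 /\ is_face (s1 `&` s2) s2].

End Cones.

Section RayIdeals.
Variables (R : realType) (n : nat) (A : comNzRingType).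
Variable A_ : 'rV[int]_n -> set A.
Implicit Types (J : set A) (s t : set 'rV[R]_n).

Definition ray_gen_ideal (a : 'rV[rat]_n) : set A :=
  ideal_gen (\bigcup_(b in [set b | exists2 r : R, 0 < r &
                                    intv R b = r *: ratv R a]) A_ b).

Definition ray_ideal (a : 'rV[rat]_n) : set A := radical (ray_gen_ideal a).

Definition nonzero_ray_ideal J : Prop :=
  (exists a, J = ray_ideal a) /\ J <> [set 0].

Definition ray_ideal_cone s : Prop :=
  [/\ is_cone s, rational_span (diffset s)
    & forall a b, relint s (ratv R a) -> relint s (ratv R b) ->
        ray_ideal a = ray_ideal b /\ ray_ideal a <> [set 0]].

Definition ray_ideal_cone_of J s : Prop :=
  ray_ideal_cone s /\ exists2 a, relint s (ratv R a) & J = ray_ideal a.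

Definition maximal_ray_ideal_cone J s : Prop :=
  ray_ideal_cone_of J s /\
  forall t, ray_ideal_cone_of J t -> s `<=` t -> t = s.

End RayIdeals.

(* Main.v *)
(** Write J_a for the ray ideals. Since J_a and J_b intersect inside J_(a+b), the
    rational points b with J_a in J_b form a convex cone; A is generated by
    finitely many homogeneous elements, and J_b depends only on which of the
    closed cones spanned by subsets of their degrees contain b, so that this cone
    is rational polyhedral. Its real counterpart is sigma_J for J = J_a. Two facts
    give the rest.
    (i) If J_a is nonzero and contained in J_b and J_c, then J_(b+c) is contained
    in J_b, by the determinant trick: after replacing b and c by multiples, every
    z in A_(b+c) maps A_(ka) into A_b A_c A_(ka) for k large. Hence J_b = J for b
    in the relative interior of sigma_J.
    (ii) If J_a is contained in J_b, then also in J_(Na-b) for some N > 0, so that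
    a lies in the relative interior of its cone, and the cones attached to the
    points of sigma_J are its faces. *)

From HB Require Import structures.
Require Import Defs.
From mathcomp Require Import zify ring lra.

Set Implicit Arguments.
Unset Strict Implicit.
Unset Printing Implicit Defensive.

Import Order.TTheory GRing.Theory Num.Theory.
Import numFieldNormedType.Exports.

Local Open Scope classical_set_scope.
Local Open Scope ring_scope.

(** * Ideals *)

(** Two reductions carry the argument. Up to radical, [J_b] is generated in a single degree [K b]:
    finitely many generators have degrees [e_i b], and suitable powers of them meet in the degree
    given by the product of the [e_i]. Radicals attached to different rays can then be multiplied
    and compared degree by degree, which both (i) and (ii) rely on. The second reduction concerns
    real cones. Ray ideals see only rational points, while the cones competing for maximality are
    real ones, not assumed closed or polyhedral. Hence the inequalities used are rational and valid
    over [rat] and over the reals alike (Fourier-Motzkin elimination), and a real point violating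
    one of them is traded for a rational point of the relative interior that violates it too. *)

Section IdealTheory.
Variable A : comNzRingType.
Implicit Types (S I : set A) (x y : A).

Lemma ideal_gen_ideal S : is_ideal (ideal_gen S).
Proof.
split=> [I [[]]//|x y Sx Sy I SI|c x Sx I SI].
  by have [[_ ID _] _] := SI; apply: ID; [exact: Sx|exact: Sy].
by have [[_ _ IM] _] := SI; apply: IM; exact: Sx.
Qed.

Lemma ideal_sum I (idI : is_ideal I) (T : eqType) (r : seq T) (F : T -> A) :
  (forall i, i \in r -> I (F i)) -> I (\sum_(i <- r) F i).
Proof.
case: idI => I0 ID _; elim: r => [|i r IHr] IF; first by rewrite big_nil.
rewrite big_cons; apply: ID; first by apply: IF; rewrite mem_head.
by apply: IHr => j jr; apply: IF; rewrite inE jr orbT.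
Qed.

Lemma ideal_fin_sum I (idI : is_ideal I) (T : finType) (F : T -> A) :
  (forall i, I (F i)) -> I (\sum_i F i).
Proof. by move=> IF; apply: ideal_sum. Qed.

Lemma idealMr I (idI : is_ideal I) x c : I x -> I (x * c).
Proof. by case: idI => _ _ IM Ix; rewrite mulrC; apply: IM. Qed.

Lemma ideal_genX S I x y : is_ideal I ->
  (forall s, S s -> I (s * y)) -> ideal_gen S x -> I (x * y).
Proof.
move=> [I0 ID IM] SI.
apply: (@smallest_sub _ _ S [set x | I (x * y)]) => //; split => /=.
- by rewrite mul0r.
- by move=> u v Iu Iv; rewrite mulrDl; apply: ID.
- by move=> c u Iu; rewrite -mulrA; apply: IM.
Qed.

Lemma radical_sub I : I `<=` radical I.
Proof. by move=> x Ix; exists 1%N. Qed.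

Lemma radical_exp I (idI : is_ideal I) x k j :
  I (x ^+ k) -> (k <= j)%N -> I (x ^+ j).
Proof.
by move=> Ik kj; rewrite -(subnK kj) exprD; case: idI => _ _; apply.
Qed.

Lemma radical_ideal I : is_ideal I -> is_ideal (radical I).
Proof.
move=> idI; have [I0 ID IM] := idI; split; first by exists 1%N.
  move=> x y [p Ip] [q Iq]; exists (p + q)%N; rewrite exprDn.
  apply: ideal_sum => // i _; rewrite -mulr_natr; apply: idealMr => //.
  have [ip|ip] := leqP q i.
    by apply: IM; apply: radical_exp Iq ip.
  apply: idealMr => //; apply: radical_exp Ip _ => //.
  by move: ip; lia.
by move=> c x [p Ip]; exists p; rewrite exprMn; apply: IM.
Qed.

Lemma radical_exp_inv I x k : radical I (x ^+ k) -> radical I x.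
Proof. by move=> [j]; rewrite -exprM; exists (k * j)%N. Qed.

Lemma sub_radical I I' : is_ideal I' -> I `<=` radical I' ->
  radical I `<=` radical I'.
Proof. by move=> idI' II' x [k /II']; apply: radical_exp_inv. Qed.

Lemma ideal_gen_ordP m (h : 'I_m -> A) x :
  ideal_gen (range h) x <-> exists t, x = \sum_i t i * h i.
Proof.
split=> [|[t ->]]; last first.
  have [_ _ GM] := ideal_gen_ideal (range h).
  apply: ideal_fin_sum => [|i]; first exact: ideal_gen_ideal.
  by apply: GM; apply: sub_gen_smallest; exists i.
apply: (@smallest_sub _ _ _ [set x | exists t, x = \sum_i t i * h i]).
  split=> /=.
  - by exists (fun=> 0); rewrite big1 // => i _; rewrite mul0r.
  - move=> _ _ [t ->] [s ->]; exists (fun i => t i + s i).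
    by rewrite -big_split; apply: eq_bigr => i _; rewrite mulrDl.
  - move=> c _ [t ->]; exists (fun i => c * t i).
    by rewrite mulr_sumr; apply: eq_bigr => i _; rewrite mulrA.
move=> _ [i _ <-]; exists (fun j => (j == i)%:R).
rewrite (bigD1 i) //= eqxx mul1r big1 ?addr0 // => j /negPf->.
by rewrite mul0r.
Qed.

Lemma set_seq_range (s : seq A) : [set` s] = range (fun i : 'I_(size s) => s`_i).
Proof.
apply/seteqP; split => [y /= ys|_ [i _ <-] /=]; last by rewrite mem_nth.
have ys' : (index y s < size s)%N by rewrite index_mem.
by exists (Ordinal ys') => //=; rewrite nth_index.
Qed.

Lemma ideal_gen_finite S x : ideal_gen S x ->
  exists s : seq A, (forall y, y \in s -> S y) /\ ideal_gen [set` s] x.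
Proof.
apply: (@smallest_sub _ _ _ [set x | exists s : seq A,
  (forall y, y \in s -> S y) /\ ideal_gen [set` s] x]); first split => /=.
- by exists [::]; split => //; have [] := ideal_gen_ideal [set` Nil A].
- move=> u v [s [sS su]] [t [tS tv]]; exists (s ++ t); split.
    by move=> y; rewrite mem_cat => /orP[/sS|/tS].
  have [_ GD _] := ideal_gen_ideal [set` s ++ t].
  have sub (r : seq A) : {subset r <= s ++ t} ->
      ideal_gen [set` r] `<=` ideal_gen [set` s ++ t].
    move=> rst; apply: smallest_sub; first exact: ideal_gen_ideal.
    by move=> y yr; apply: sub_gen_smallest; exact: rst.
  by apply: GD; [apply: sub su|apply: sub tv] => y yr; rewrite mem_cat yr ?orbT.
- move=> c u [s [sS su]]; exists s; split => //.
  by have [_ _] := ideal_gen_ideal [set` s]; apply.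
- move=> u Su; exists [:: u]; split; first by move=> y; rewrite inE => /eqP->.
  by apply: sub_gen_smallest => /=; rewrite mem_head.
Qed.

(** [noetherian] gives generators of the ideal that need not belong to [S]. Each of them involves
    only finitely many members of [S], and these are collected; this is how generators can be taken
    homogeneous. *)
Lemma noetherian_gen S : noetherian A ->
  exists s : seq A, (forall y, y \in s -> S y) /\
    ideal_gen S `<=` ideal_gen [set` s].
Proof.
move=> /(_ _ (ideal_gen_ideal S))[s Ss].
have sS : forall y, y \in s -> ideal_gen S y.
  by rewrite Ss => y ys; apply: sub_gen_smallest.
suff [r [rS rs]] : exists r : seq A, (forall y, y \in r -> S y) /\
    forall y, y \in s -> ideal_gen [set` r] y.
  exists r; split => //; rewrite Ss.
  by apply: smallest_sub => //; exact: ideal_gen_ideal.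
elim: s sS {Ss} => [|y s IHs] sS; first by exists [::].
have [|r [rS rs]] := IHs; first by move=> z zs; apply: sS; rewrite inE zs orbT.
have [|t [tS ty]] := @ideal_gen_finite S y; first by apply: sS; rewrite mem_head.
exists (t ++ r); split; first by move=> z; rewrite mem_cat => /orP[/tS|/rS].
have sub (q : seq A) : {subset q <= t ++ r} ->
    ideal_gen [set` q] `<=` ideal_gen [set` t ++ r].
  move=> qtr; apply: smallest_sub; first exact: ideal_gen_ideal.
  by move=> z zr; apply: sub_gen_smallest; exact: qtr.
move=> z; rewrite inE => /orP[/eqP->|/rs rz].
  by apply: sub ty => w wt; rewrite mem_cat wt.
by apply: sub rz => w wt; rewrite mem_cat wt orbT.
Qed.

Lemma prod_congr_ideal I (idI : is_ideal I) m (F G : 'I_m -> A) :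
  (forall i, I (F i - G i)) -> I (\prod_i F i - \prod_i G i).
Proof.
have [I0 ID IM] := idI => FG.
apply: (big_ind2 (fun a b => I (a - b))) => // [|a b c d ab cd].
  by rewrite subrr.
have -> : a * c - b * d = c * (a - b) + b * (c - d).
  by ring.
by apply: ID; apply: IM.
Qed.

End IdealTheory.

(* The determinant trick: [\det (z%:M - P)] is congruent to [z ^+ m] modulo [I]
   and kills [u]. *)
Lemma det_trick (A : idomainType) (I : set A) (idI : is_ideal I) m
    (u : 'I_m -> A) (z : A) (P : 'I_m -> 'I_m -> A) i0 :
  u i0 != 0 -> (forall i j, I (P i j)) ->
  (forall i, z * u i = \sum_j P i j * u j) -> radical I z.
Proof.
move=> u0 IP zu; have [I0 ID IM] := idI.
pose M : 'M[A]_m := z%:M - \matrix_(i, j) P i j.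
pose v : 'cV[A]_m := \col_j u j.
have Mv : M *m v = 0.
  apply/colP => i; rewrite mulmxBl mul_scalar_mx !mxE zu.
  by rewrite [X in _ - X](eq_bigr (fun j => P i j * u j)) ?subrr // => j _; rewrite !mxE.
have detM : \det M = 0.
  have : \adj M *m (M *m v) = 0 by rewrite Mv mulmx0.
  rewrite mulmxA mul_adj_mx mul_scalar_mx => /colP/(_ i0); rewrite !mxE.
  by move/eqP; rewrite mulf_eq0 (negPf u0) orbF => /eqP.
exists m; rewrite -det_scalar -[\det _]subr0 -detM /determinant -sumrB.
apply: ideal_fin_sum => // s; rewrite -mulrBr; apply: IM.
apply: prod_congr_ideal => // i; rewrite !mxE opprB addrC subrK; exact: IP.
Qed.

(** * Homogeneous elements *)

Section Grading.
Variables (n : nat) (A : idomainType) (A_ : 'rV[int]_n -> set A).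
Hypothesis gradA : is_grading A_.
Local Notation G := 'rV[int]_n.

Lemma gradingD a x y : A_ a x -> A_ a y -> A_ a (x + y).
Proof.
move=> Ax Ay; rewrite -[y]opprK; apply: (gradingB gradA) => //.
by rewrite -sub0r; apply: (gradingB gradA) => //; exact: (grading0 gradA).
Qed.

(** By uniqueness of the decomposition, each identity reduces to checking that its right-hand side
    is a decomposition. *)
Lemma grading_proj : exists pi : A -> G -> A,
  [/\ forall x b, A_ b (pi x b),
      forall x y b, pi (x + y) b = pi x b + pi y b,
      forall h d t b, A_ d h -> pi (t * h) b = pi t (b - d) * h
    & forall b x, A_ b x -> pi x b = x /\ forall c, c != b -> pi x c = 0].
Proof.
pose P x (f : G -> A) := [/\ forall a, A_ a (f a),
  finite_set [set a | f a != 0] & x = \sum_(a \in [set: G]) f a].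
have Puniq x f g : P x f -> P x g -> f = g.
  by have [h [_ hU]] := grading_direct gradA x => /hU <- /hU <-.
have [|pi piP] := @choice _ _ P.
  by move=> x; have [h [Ph _]] := grading_direct gradA x; exists h.
have pi_uniq x f : P x f -> pi x = f by apply: Puniq.
exists pi; split.
- by move=> x b; have [] := piP x.
- move=> x y b; suff -> : pi (x + y) = fun b => pi x b + pi y b by [].
  have [Ax fx xE] := piP x; have [Ay fy yE] := piP y.
  pose D := [set a | pi x a != 0] `|` [set a | pi y a != 0].
  have finD : finite_set D by rewrite finite_setU.
  have wD (f : G -> A) : (forall a, f a != 0 -> D a) ->
      \sum_(a \in [set: G]) f a = \sum_(a \in D) f a.
    move=> fD; symmetry; apply: fsbig_widen => // a [_ Da] /=.
    by apply/eqP; apply: contra_notT Da => /fD.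
  have subD a : pi x a + pi y a != 0 -> D a.
    by have [->|] := eqVneq (pi x a) 0; [rewrite add0r; right|left].
  apply: pi_uniq; split; first by move=> a; apply: gradingD.
    exact: sub_finite_set finD.
  rewrite wD // fsbig_split //= -!wD -?xE -?yE // => a; first by right.
  by left.
- move=> h d t b Ah.
  suff -> : pi (t * h) = fun b => pi t (b - d) * h by [].
  have [At ft tE] := piP t.
  apply: pi_uniq; split.
  + by move=> a; rewrite -{1}(subrK d a); apply: (gradingM gradA).
  + apply: (@sub_finite_set _ _ ((fun a => a + d) @` [set a | pi t a != 0])).
      move=> a /=; rewrite mulf_eq0 negb_or => /andP[nz _].
      by exists (a - d) => //; rewrite subrK.
    exact: finite_image.
  + rewrite {1}tE mulr_fsuml.
    rewrite (reindex_fsbigT (fun a : G => a - d)) //.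
    by exists (fun a => a + d) => a; rewrite ?subrK ?addrK.
- move=> b x Ax.
  have -> : pi x = fun c => if c == b then x else 0.
    apply: pi_uniq; split.
    + by move=> a; case: (eqVneq a b) => [->//|_]; exact: (grading0 gradA).
    + apply: (@sub_finite_set _ _ [set b]); last exact: finite_set1.
      by move=> a /=; case: (eqVneq a b) => // _; rewrite eqxx.
    + transitivity (\sum_(a \in [set b]) if a == b then x else 0).
        by rewrite fsbig_set1 /= eqxx.
      apply: fsbig_widen => // a [_ /=].
      by case: (eqVneq a b) => // ->.
  by rewrite eqxx; split => // c /negPf->.
Qed.

Lemma grading_eq0 b c x : b != c -> A_ b x -> A_ c x -> x = 0.
Proof.
have [pi [_ _ _ piH]] := grading_proj => bc /piH[xb _] /piH[_ /(_ _ bc)].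
by rewrite xb.
Qed.

(** Comparing components of degree [b] replaces each coefficient by its component of degree
    [b - d i]. *)
Lemma hom_coef (T : eqType) (r : seq T) (d : T -> G) (h t : T -> A) b x :
  (forall i, i \in r -> A_ (d i) (h i)) -> A_ b x ->
  x = \sum_(i <- r) t i * h i ->
  exists2 t', forall i, A_ (b - d i) (t' i) & x = \sum_(i <- r) t' i * h i.
Proof.
have [pi [piA piD piM piH]] := grading_proj => Ah Ax xE.
exists (fun i => pi (t i) (b - d i)) => //.
have pi0 : pi 0 b = 0.
  by apply: (addrI (pi 0 b)); rewrite -piD !addr0.
rewrite -{1}(piH _ _ Ax).1 xE.
elim: r Ah {xE} => [|i r IHr] Ah; first by rewrite !big_nil.
rewrite !big_cons piD IHr ?(piM _ (d i)) //; first by apply: Ah; rewrite mem_head.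
by move=> j jr; apply: Ah; rewrite inE jr orbT.
Qed.

(** The form in which noetherianity enters all later arguments: the degrees of the coefficients are
    what gets exploited. *)
Lemma hom_noetherian (B : set G) : noetherian A ->
  exists m (d : 'I_m -> G) (h : 'I_m -> A),
    (forall i, B (d i) /\ A_ (d i) (h i)) /\
    forall b x, A_ b x -> ideal_gen (\bigcup_(c in B) A_ c) x ->
      exists2 t, forall i, A_ (b - d i) (t i) & x = \sum_i t i * h i.
Proof.
move=> /noetherian_gen-/(_ (\bigcup_(c in B) A_ c))[s [sB Bs]].
have [deg degP] : exists deg : A -> G, forall y, y \in s ->
    B (deg y) /\ A_ (deg y) y.
  have : forall y, exists d, y \in s -> B d /\ A_ d y.
    move=> y; have [/sB[d Bd Ay]|] := boolP (y \in s); first by exists d.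
    by exists 0.
  by move=> /choice[deg degP]; exists deg => y; exact: degP.
exists (size s), (fun i => deg s`_i), (fun i => s`_i); split.
  by move=> i; apply: degP; rewrite mem_nth.
move=> b x Ax /Bs; rewrite set_seq_range => /ideal_gen_ordP[t xE].
apply: hom_coef Ax xE => i _; by have [] := degP _ (mem_nth 0 (ltn_ord i)).
Qed.

End Grading.

(** * Ray ideals of integral degrees *)

Section IntegralRays.
Variables (n : nat) (A : idomainType) (A_ : 'rV[int]_n -> set A).
Hypotheses (gradA : is_grading A_) (noethA : noetherian A) (A01 : A_ 0 1).
Local Notation G := 'rV[int]_n.
Implicit Types (a b c : G) (x y z : A).

Definition multiples b : set G := [set b *+ m | m in [set m : nat | (0 < m)%N]].

Definition deg_ideal b : set A := ideal_gen (A_ b).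

Definition int_ray_gen b : set A := ideal_gen (\bigcup_(c in multiples b) A_ c).

(** A ray ideal without real scalars. The ray of [b] may contain integral points that are not
    multiples of [b]; the radical absorbs them, see [ray_idealE]. *)
Definition int_ray b : set A := radical (int_ray_gen b).

Lemma grading_exp b x k : A_ b x -> A_ (b *+ k) (x ^+ k).
Proof.
move=> Ax; elim: k => [|k IHk]; first by rewrite mulr0n expr0.
by rewrite mulrS exprS; apply: (gradingM gradA).
Qed.

Lemma int_ray_ideal b : is_ideal (int_ray b).
Proof. exact/radical_ideal/ideal_gen_ideal. Qed.

Lemma hom_int_ray_gen b m x : (0 < m)%N -> A_ (b *+ m) x -> int_ray_gen b x.
Proof.
by move=> m0 Ax; apply: sub_gen_smallest; exists (b *+ m) => //; exists m.
Qed.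

Lemma hom_int_ray b m x : (0 < m)%N -> A_ (b *+ m) x -> int_ray b x.
Proof. by move=> m0 Ax; apply: radical_sub; apply: hom_int_ray_gen Ax. Qed.

Lemma deg_ideal_sub b m : (0 < m)%N -> deg_ideal (b *+ m) `<=` int_ray_gen b.
Proof.
move=> m0; apply: smallest_sub; first exact: ideal_gen_ideal.
by move=> x; apply: hom_int_ray_gen.
Qed.

(** With generators [h i] of degree [e i] times [b] and [K] the product of the [e i], the power of
    [h i] with exponent [K * j / e i] has degree [K * j] times [b]. The free factor [j] lets two
    rays share one constant. *)
Lemma int_ray_exact b : exists2 K, (0 < K)%N & forall j, (0 < j)%N ->
  int_ray b `<=` radical (deg_ideal (b *+ (K * j))).
Proof.
have [m [d [h [dh hgen]]]] := hom_noetherian gradA (multiples b) noethA.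
have /choice[e eP] : forall i, exists k, (0 < k)%N /\ d i = b *+ k.
  by move=> i; have [[k k0 <-] _] := dh i; exists k.
exists (\prod_i e i)%N => [|j j0].
  by apply: prodn_gt0 => i; have [] := eP i.
apply: sub_radical; first exact: ideal_gen_ideal.
have idr : is_ideal (radical (deg_ideal (b *+ (\prod_i e i * j)))).
  exact/radical_ideal/ideal_gen_ideal.
have [_ _ rM] := idr; apply: smallest_sub => // x [c bc Ax].
have [|t _ ->] := hgen _ _ Ax; first by apply: sub_gen_smallest; exists c.
apply: ideal_fin_sum => // i; apply: rM.
exists ((\prod_(k | k != i) e k) * j)%N; apply: sub_gen_smallest.
have := grading_exp ((\prod_(k | k != i) e k) * j)%N (dh i).2.
by rewrite (eP i).2 -mulrnA mulnA [in X in _ -> X](bigD1 i).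
Qed.

Lemma int_ray_exact2 a b : exists2 K, (0 < K)%N & forall j, (0 < j)%N ->
  int_ray a `<=` radical (deg_ideal (a *+ (K * j))) /\
  int_ray b `<=` radical (deg_ideal (b *+ (K * j))).
Proof.
have [Ka Ka0 aP] := int_ray_exact a; have [Kb Kb0 bP] := int_ray_exact b.
exists (Ka * Kb)%N => [|j j0]; first by rewrite muln_gt0 Ka0.
split; first by rewrite -mulnA; apply: aP; rewrite muln_gt0 Kb0.
by rewrite (mulnC Ka) -mulnA; apply: bP; rewrite muln_gt0 Ka0.
Qed.

Lemma deg_idealM b c x y :
  deg_ideal b x -> deg_ideal c y -> deg_ideal (b + c) (x * y).
Proof.
have idbc : is_ideal (deg_ideal (b + c)) by exact: ideal_gen_ideal.
move=> bx cy; apply: ideal_genX bx => // s As; rewrite mulrC.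
apply: ideal_genX cy => // t At; rewrite mulrC.
by apply: sub_gen_smallest; apply: (gradingM gradA).
Qed.

Lemma int_rayD b c x : int_ray b x -> int_ray c x -> int_ray (b + c) x.
Proof.
have [K K0 /(_ 1%N isT)[Kb Kc]] := int_ray_exact2 b c.
move=> /Kb[p bx] /Kc[q cx]; exists (p + q)%N; rewrite exprD.
apply: (@deg_ideal_sub _ K) => //.
by rewrite mulrnDl -[K]muln1; apply: deg_idealM.
Qed.

Lemma int_ray0 x : int_ray 0 x.
Proof.
exists 0%N; rewrite expr0; exact: (@hom_int_ray_gen _ 1).
Qed.

(** For [N] large, the [N]-th powers of the generators of [A_(Ka)] lie in the ideal generated by
    [A_(Kb)]. Their homogeneous coefficients have degree [K (N a - b)], hence lie in the ray ideal
    of [N a - b]. *)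
Lemma int_ray_sub_opp a b : int_ray a `<=` int_ray b ->
  exists2 N, (0 < N)%N & int_ray a `<=` int_ray (a *+ N - b).
Proof.
have [K K0 /(_ 1%N isT)] := int_ray_exact2 a b; rewrite muln1 => -[aK bK] ab.
have [m [d [g [dg ggen]]]] := hom_noetherian gradA [set a *+ K] noethA.
have [s [e [h [eh hgen]]]] := hom_noetherian gradA [set b *+ K] noethA.
have Eb : deg_ideal (b *+ K) `<=` ideal_gen (\bigcup_(c in [set b *+ K]) A_ c).
  by rewrite bigcup_set1.
have /choice[p pP] : forall i, exists k, deg_ideal (b *+ K) (g i ^+ k).
  move=> i; apply/bK/ab; apply: (@hom_int_ray _ K) => //.
  by have [<- ] := dg i.
(* The successor keeps [N] positive even if all exponents vanish or there are no generators. *)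
pose N := (\max_i p i).+1; exists N => //.
have idN := int_ray_ideal (a *+ N - b); have [_ _ NM] := idN.
apply: (subset_trans aK); apply: sub_radical; first exact: ideal_gen_ideal.
apply: smallest_sub => // x Ax.
have [|t _ ->] := ggen _ _ Ax; first by apply: sub_gen_smallest; exists (a *+ K).
apply: ideal_fin_sum => // i; apply: NM; apply: (@radical_exp_inv _ _ _ N).
have [dE Ag] := dg i.
have [||u Au ->] := hgen (a *+ K *+ N) (g i ^+ N).
- by rewrite -dE; apply: grading_exp.
- apply: Eb; apply: radical_exp (pP i) _; first exact: ideal_gen_ideal.
  by apply: leqW; apply: leq_bigmax.
apply: ideal_fin_sum => // j; apply: idealMr => //.
apply: (@hom_int_ray _ K) => //.
by have := Au j; have [-> _] := eh j; rewrite mulrnBl -!mulrnA (mulnC K).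
Qed.

(** Expanding an element, then its coefficients, and so on, produces monomials in the [g i]. If the
    initial degree is large, this can continue until some exponent reaches [N], and the monomial is
    then in [D]. *)
Lemma ray_eventually_sub a m (e : 'I_m -> nat) (g : 'I_m -> A) (D : set A) :
  is_ideal D -> (forall i, (0 < e i)%N) -> (forall i, radical D (g i)) ->
  (forall j x, (0 < j)%N -> A_ (a *+ j) x ->
    exists2 t, forall i, A_ (a *+ j - a *+ e i) (t i) & x = \sum_i t i * g i) ->
  exists M, forall j x, (M <= j)%N -> A_ (a *+ j) x -> D x.
Proof.
move=> idD e0 gD ggen; have [D0 DD DM] := idD.
have [N NP] : exists N, forall i, D (g i ^+ N).
  have [p pP] := choice gD.
  by exists (\max_i p i)%N => i; apply: radical_exp (pP i) _ => //; apply: leq_bigmax.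
(* The monomial collected so far has exponents [f]; [q] bounds the number of factors that can still
   be added before every exponent is at least [N]. *)
suff H q (f : 'I_m -> nat) : (\sum_i (N - f i) <= q)%N ->
    exists M, forall j x, (M <= j)%N -> A_ (a *+ j) x -> D (x * \prod_i g i ^+ f i).
  have [M MP] := H _ (fun=> 0%N) (leqnn _).
  by exists M => j x Mj Ax; have := MP j x Mj Ax; rewrite big1 // mulr1.
elim: q f => [|q IHq] f fq.
- have [[i fi]|nf] := pselect (exists i, (N <= f i)%N).
    exists 0%N => j x _ _; apply: DM; rewrite (bigD1 i) //=.
    by apply: idealMr => //; apply: radical_exp (NP i) fi.
  (* A zero bound forces [N <= f i] for every [i], so here there is no index at all and the
     expansion of [x] is an empty sum. *)
  exists 1%N => j x j0 Ax; have [t _ ->] := ggen _ _ j0 Ax.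
  rewrite big1 ?mul0r // => i _; case: nf; exists i.
  by move: fq; rewrite leqn0 sum_nat_eq0 => /forallP/(_ i); rewrite subn_eq0.
- have [[i fi]|nf] := pselect (exists i, (N <= f i)%N).
    exists 0%N => j x _ _; apply: DM; rewrite (bigD1 i) //=.
    by apply: idealMr => //; apply: radical_exp (NP i) fi.
  have /choice[M MP] : forall i, exists M, forall j x, (M <= j)%N ->
      A_ (a *+ j) x -> D (x * \prod_k g k ^+ (f k + (k == i))).
    move=> i; apply: IHq; rewrite -ltnS; apply: leq_trans fq.
    have fi : (f i < N)%N by rewrite ltnNge; apply/negP => fi; apply: nf; exists i.
    rewrite (bigD1 i) //= [X in (_ < X)%N](bigD1 i) //= eqxx addn1.
    rewrite -addSn leq_add //; first by rewrite subnS prednK // subn_gt0.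
    by apply: leq_sum => k _; apply: leq_sub2l; apply: leq_addr.
  (* The coefficient of [g i] has degree [j - e i], which must still be at least [M i]; the
     successor makes [j] positive, as [ggen] requires. *)
  exists (\max_i (M i + e i)).+1 => j x Mj Ax.
  have [|t At ->] := ggen _ _ _ Ax; first exact: leq_trans Mj.
  rewrite mulr_suml; apply: ideal_fin_sum => // i.
  have Mij : (M i + e i <= j)%N.
    by apply: leq_trans (ltnW Mj); apply: (@leq_bigmax _ (fun i => M i + e i)%N).
  have -> : t i * g i * \prod_k g k ^+ f k = t i * \prod_k g k ^+ (f k + (k == i)).
    rewrite -mulrA; congr (_ * _).
    rewrite (bigD1 i) //= [in RHS](bigD1 i) //= eqxx addn1 exprS mulrA.
    by congr (_ * _); apply: eq_bigr => k /negPf->; rewrite addn0.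
  apply: (MP i (j - e i)%N); first by rewrite leq_subRL ?(leq_trans _ Mij) ?leq_addl // addnC.
  by rewrite mulrnBr // (leq_trans _ Mij) // leq_addl.
Qed.

(* Every homogeneous [z] of degree [b' + c'] (large multiples of [b] and [c])
   maps [A_(ka)], k large, into [A_b' A_c' A_(ka)]: the determinant trick then
   makes [z] integral over the ideal generated by [A_b'].  This is where the
   properness of the quotients enters the theory of GIT fans. *)
Lemma int_ray_add_sub a b c : int_ray a <> [set 0] ->
  int_ray a `<=` int_ray b -> int_ray a `<=` int_ray c ->
  int_ray (b + c) `<=` int_ray b.
Proof.
move=> a_nz ab ac.
have [K K0 KP] := int_ray_exact2 b c.
apply: sub_radical; first exact: ideal_gen_ideal.
apply: smallest_sub; first exact: int_ray_ideal.
move=> z0 [_ [m m0 <-] Az0]; apply: (@radical_exp_inv _ _ _ K).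
have {KP}[bP cP] := KP m m0; set b' := b *+ (K * m) in bP; set c' := c *+ (K * m) in cP.
have {Az0} : A_ (b' + c') (z0 ^+ K).
  by rewrite -mulrnDl mulnC mulrnA; apply: grading_exp.
move: (z0 ^+ K) => z {z0} Az.
have b'b : deg_ideal b' `<=` int_ray_gen b.
  by apply: deg_ideal_sub; rewrite muln_gt0 K0.
have idb' : is_ideal (deg_ideal b') by exact: ideal_gen_ideal.
suff [k kz] : radical (deg_ideal b') z by exists k; apply: b'b.
(* A power of each element of the ray ideal of [a] lies in the ideal of [A_b'], another in that of
   [A_c']; their product is in [D]. *)
pose D := ideal_gen [set x * y | x in A_ b' & y in A_ c'].
have idD : is_ideal D by exact: ideal_gen_ideal.
have aD : int_ray a `<=` radical D.
  move=> x ax; have [p bx] := bP _ (ab _ ax); have [q cx] := cP _ (ac _ ax).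
  exists (p + q)%N; rewrite exprD; apply: ideal_genX bx => // s As.
  rewrite mulrC; apply: ideal_genX cx => // t At; rewrite mulrC.
  by apply: sub_gen_smallest; exists s => //; exists t.
have [M MP] : exists M, forall j x, (M <= j)%N -> A_ (a *+ j) x -> D x.
  have [r [d [g [dg ggen]]]] := hom_noetherian gradA (multiples a) noethA.
  have /choice[e eP] : forall i, exists k, (0 < k)%N /\ d i = a *+ k.
    by move=> i; have [[k k0 <-] _] := dg i; exists k.
  apply: (@ray_eventually_sub a r e g) => //.
  - by move=> i; have [] := eP i.
  - move=> i; apply: aD; have [_] := dg i; rewrite (eP i).2.
    by apply: hom_int_ray; have [] := eP i.
  move=> j x j0 Ax; have [|t At xE] := ggen _ _ Ax.
    by apply: sub_gen_smallest; exists (a *+ j) => //; exists j.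
  by exists t => // i; have := At i; rewrite (eP i).2.
(* The shifted degrees are those of [z * u] with [u] of degree [k a]. Finitely many generators in
   degrees [e i] times [a] plus [b' + c'] have coefficients of degree [(k - e i) a], which lie in
   [D] once [k] is large. *)
have [M' M'P] : exists M', forall k x, (M' <= k)%N -> A_ (a *+ k + (b' + c')) x -> D x.
  have [r [d [g [dg ggen]]]] :=
    hom_noetherian gradA (range (fun k => a *+ k + (b' + c'))) noethA.
  have /choice[e eP] : forall i, exists k, d i = a *+ k + (b' + c').
    by move=> i; have [[k k0 <-] _] := dg i; exists k.
  exists (M + \max_i e i)%N => k x Mk Ax; have [|t At ->] := ggen _ _ Ax.
    by apply: sub_gen_smallest; exists (a *+ k + (b' + c')) => //; exists k.
  apply: ideal_fin_sum => // i; apply: (idealMr idD).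
  have ei : (e i <= \max_i e i)%N by apply: leq_bigmax.
  apply: (MP (k - e i)%N); first by move: ei Mk; lia.
  rewrite mulrnBr; last by move: ei Mk; lia.
  by have := At i; rewrite eP opprD addrACA subrr addr0.
(* A non-zero ray ideal provides a non-zero homogeneous [y] on the ray, and in a domain its power
   [y ^+ M'] is non-zero of large degree. *)
have [k Mk [u0 Au0 u0nz]] : exists2 k, (M' <= k)%N & exists2 u, A_ (a *+ k) u & u != 0.
  apply: contrapT => noU; apply: a_nz; apply/seteqP; split; last first.
    by move=> _ ->; have [] := int_ray_ideal a.
  move=> x [q]; suff a0 : int_ray_gen a `<=` [set 0].
    by move=> /a0/eqP; rewrite expf_eq0 => /andP[_ /eqP].
  apply: smallest_sub.
    split => [//|y w /= -> ->|w y /= ->]; first exact: addr0.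
    exact: mulr0.
  move=> y [_ [j j0 <-] Ay]; apply: contrapT => /eqP ynz; apply: noU.
  exists (j * M')%N; first by rewrite leq_pmull.
  exists (y ^+ M'); first by rewrite mulrnA; apply: grading_exp.
  by rewrite expf_neq0.
have [r [d [u [du ugen]]]] := hom_noetherian gradA [set a *+ k] noethA.
have Agen x : A_ (a *+ k) x -> exists t, x = \sum_i t i * u i.
  move=> Ax; have [|t _ ->] := ugen _ _ Ax; last by exists t.
  by apply: sub_gen_smallest; exists (a *+ k).
have [i0 ui0] : exists i, u i != 0.
  apply: contrapT => u_eq0; case/eqP: u0nz; have [t ->] := Agen _ Au0.
  rewrite big1 // => i _; have [->|ui] := eqVneq (u i) 0; first by rewrite mulr0.
  by case: u_eq0; exists i.
(* [z * u i] is a combination of products [v * w] with [v] in [A_b'] and [w] in [A_c']. By degree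
   its coefficients lie in [A_(ka)], so they expand in the [u l]; the factors [v] put the resulting
   matrix entries in the ideal of [A_b']. *)
have comb i : exists P : 'I_r -> A, (forall j, deg_ideal b' (P j)) /\
    z * u i = \sum_j P j * u j.
  have Azu : A_ (a *+ k + (b' + c')) (z * u i).
    by rewrite addrC; apply: (gradingM gradA) => //; have [<-] := du i.
  have [s [sS]] := ideal_gen_finite (M'P _ _ Mk Azu).
  rewrite set_seq_range => /ideal_gen_ordP[t tE].
  have sA (j : 'I_(size s)) : exists2 v, A_ b' v & exists2 w, A_ c' w & s`_j = v * w.
    by have [v Av [w Aw <-]] := sS _ (mem_nth 0 (ltn_ord j)); exists v => //; exists w.
  have [t' At' ->] : exists2 t' : 'I_(size s) -> A, forall j, A_ (a *+ k) (t' j) &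
      z * u i = \sum_j t' j * s`_j.
    have [|t' At' tE'] := @hom_coef _ _ _ gradA _ _ (fun=> b' + c') _ _ _ _ _ Azu tE.
      by move=> j _; have [v Av [w Aw ->]] := sA j; apply: (gradingM gradA).
    by exists t' => // j; have := At' j; rewrite addrK.
  have {}At' j : exists q : 'I_r -> A, t' j = \sum_l q l * u l by exact: Agen.
  have [q qP] := choice At'.
  exists (fun l => \sum_j q j l * s`_j); split.
    move=> l; apply: ideal_fin_sum => // j; have [_ _] := idb'; apply.
    have [v Av [w _ ->]] := sA j; apply: (idealMr idb').
    exact: sub_gen_smallest.
  under eq_bigr do rewrite qP mulr_suml.
  rewrite exchange_big; apply: eq_bigr => l _ /=; rewrite mulr_suml.
  by apply: eq_bigr => j _; rewrite mulrAC.
have [P PP] := choice comb.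
by apply: (@det_trick _ _ idb' r u z P i0) => // [i|i]; have [] := PP i.
Qed.

End IntegralRays.

(** * Finite generation *)

Section Monomials.
Variables (n : nat) (A : idomainType) (A_ : 'rV[int]_n -> set A).
Hypotheses (gradA : is_grading A_) (noethA : noetherian A) (A01 : A_ 0 1).
Local Notation G := 'rV[int]_n.
Implicit Types (b c : G) (x y : A) (l s : seq (G * A)).

(** Generators carry their degree, since an element does not determine it: zero lies in every
    component. *)
Inductive monomial l : G -> A -> Prop :=
| Monomial1 : monomial l 0 1
| MonomialM p b y : p \in l -> monomial l b y -> monomial l (p.1 + b) (p.2 * y).

Lemma monomial_sub l l' b : {subset l <= l'} -> monomial l b `<=` monomial l' b.
Proof.
by move=> ll' y; elim=> [|p {}b {}y /ll' pl _]; [exact: Monomial1|exact: MonomialM].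
Qed.

Lemma monomial_exp l b y : monomial l b y -> exists e : 'I_(size l) -> nat,
  b = \sum_i (tnth (in_tuple l) i).1 *+ e i /\
  y = \prod_i (tnth (in_tuple l) i).2 ^+ e i.
Proof.
elim=> [|p {}b {}y pl _ [e [-> ->]]].
  by exists (fun=> 0%N); split; [rewrite big1|rewrite big1].
have /tnthP[i ->] : p \in in_tuple l by [].
exists (fun j => (j == i) + e j)%N.
split; rewrite (bigD1 i) //= [in RHS](bigD1 i) //= eqxx.
  by rewrite mulrS addrA; congr (_ + _); apply: eq_bigr => j /negPf->.
by rewrite exprS mulrA; congr (_ * _); apply: eq_bigr => j /negPf->.
Qed.

(** An ideal stands in for the span over [A_ 0]: by [hom_coef], an element of degree [b] in the
    ideal of monomials of degree [b] has coefficients in [A_ 0]. *)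
Definition generates l (B : set G) :=
  (forall p, p \in l -> A_ p.1 p.2) /\
  forall b x, B b -> A_ b x -> ideal_gen (monomial l b) x.

(** One descent step: it suffices to generate the coefficients, whose degrees are [b] minus the
    degree of a member of [s]. *)
Lemma monomial_noetherian (B : set G) : exists s,
  (forall p, p \in s -> B p.1 /\ A_ p.1 p.2) /\
  forall l b x, B b -> A_ b x -> {subset s <= l} ->
    (forall p y, p \in s -> A_ (b - p.1) y -> ideal_gen (monomial l (b - p.1)) y) ->
    ideal_gen (monomial l b) x.
Proof.
have [m [d [h [dh hgen]]]] := hom_noetherian gradA B noethA.
exists (codom (fun i => (d i, h i))); split; first by move=> p /codomP[i ->]; exact: dh.
move=> l b x Bb Ax sl IH; have idl := ideal_gen_ideal (monomial l b).
have [|t At ->] := hgen _ _ Ax; first by apply: sub_gen_smallest; exists b.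
apply: ideal_fin_sum => // i.
have pi : (d i, h i) \in codom (fun i => (d i, h i)) by apply: codom_f.
have := IH _ _ pi (At i); apply: ideal_genX => // y my.
apply: sub_gen_smallest; rewrite mulrC -[b](subrK (d i)) addrC.
exact: MonomialM (sl _ pi) my.
Qed.

Lemma generates_sub l l' B b x : generates l B -> {subset l <= l'} ->
  B b -> A_ b x -> ideal_gen (monomial l' b) x.
Proof.
move=> [_ lB] ll' Bb Ax; apply: sub_smallest2r (lB _ _ Bb Ax).
  exact: ideal_gen_ideal.
exact: monomial_sub.
Qed.

(** Induction on [phi b]. Above the bound [N] on the generators [s], a descent step lowers [phi]
    without making it negative. Below [N] it could overshoot, so each of these finitely many slices
    gets its own generators [L j], with coefficients in the slice [phi = 0] already handled by
    [l]. *)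
Lemma generates_ge0 (H : set G) (phi : G -> int) l :
  (forall b c, H b -> H c -> H (b - c)) ->
  (forall b c, phi (b - c) = phi b - phi c) ->
  generates l [set b | H b /\ phi b = 0] ->
  exists l', generates l' [set b | H b /\ 0 <= phi b].
Proof.
move=> HB phiB lgen.
have [s [sP sgen]] := monomial_noetherian [set b | H b /\ 0 < phi b].
have /choice[L LP] := fun j : nat => monomial_noetherian [set b | H b /\ phi b = j].
pose N := (\max_(p <- s) `|phi p.1|)%N.
have [r rP] : exists r : seq nat, forall j, (j <= N)%N -> j \in r.
  by exists (iota 0 N.+1) => j; rewrite mem_iota.
pose Ls := flatten [seq L j | j <- r]; pose l' := l ++ s ++ Ls.
have l'P p : (p \in l') = [|| p \in l, p \in s | p \in Ls].
  by rewrite /l'; move: Ls {l'} => Ls; rewrite !mem_cat.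
have ll' : {subset l <= l'} by move=> p pl; rewrite l'P pl.
have sl' : {subset s <= l'} by move=> p pl; rewrite l'P pl orbT.
have Ll' j : (j <= N)%N -> {subset L j <= l'}.
  move=> jN p pl; rewrite !mem_cat; apply/orP; right; apply/orP; right.
  by apply/flatten_mapP; exists j => //; apply: rP.
exists l'; split.
  move=> p; rewrite l'P => /orP[/(lgen.1)//|/orP[/sP[]//|]].
  by move=> /flatten_mapP[j _] /((LP j).1)[].
suff IH (j : nat) b x : H b -> phi b = j -> A_ b x -> ideal_gen (monomial l' b) x.
  by move=> b x [Hb /gez0_abs/esym phib]; apply: IH phib.
elim/ltn_ind: j b x => -[|j] IH b x Hb phib Ax.
  exact: generates_sub lgen ll' _ Ax.
have [Nj|jN] := leqP N j.
  apply: (sgen _ _ _ _ Ax) => // [|p y ps Ay]; first by rewrite /= phib.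
  have [[Hp phip] _] := sP _ ps.
  have pN : (`|phi p.1| <= N)%N.
    by apply: (@leq_bigmax_seq _ _ xpredT (fun p => `|phi p.1|%N)).
  apply: (IH (j.+1 - `|phi p.1|)%N) => //; [|exact: HB|].
    by move: phip; lia.
  by rewrite phiB phib; move: phip pN Nj; lia.
have [LPj Lgen] := LP j.+1.
apply: (Lgen _ _ _ _ Ax) => // [|p y ps Ay]; first exact: Ll'.
have [[Hp phip] _] := LPj _ ps.
apply: generates_sub lgen ll' _ Ay; split; first exact: HB.
by rewrite phiB phib phip subrr.
Qed.

Lemma finitely_generated : exists l, generates l setT.
Proof.
pose H k : set G := [set b | forall i : 'I_n, (k <= i)%N -> b 0 i = 0].
suff /(_ n (leqnn n))[l [lA lgen]] : forall k, (k <= n)%N -> exists l, generates l (H k).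
  exists l; split => // b x _; apply: lgen => i.
  by rewrite leqNgt ltn_ord.
elim=> [_|k IHk kn].
  exists [::]; split => // b x Hb Ax.
  have -> : b = 0 by apply/rowP => i; rewrite mxE Hb.
  rewrite -[x]mulr1; have [_ _] := ideal_gen_ideal (monomial [::] 0).
  by apply; apply: sub_gen_smallest; apply: Monomial1.
have [l lgen] := IHk (ltnW kn); pose i0 := Ordinal kn.
have HB b c : H k.+1 b -> H k.+1 c -> H k.+1 (b - c).
  by move=> Hb Hc i ki; rewrite !mxE Hb // Hc // subrr.
have H0 b : H k.+1 b -> b 0 i0 = 0 -> H k b.
  move=> Hb b0 i; rewrite leq_eqVlt => /orP[/eqP ki|/Hb//].
  by rewrite -b0; congr (b 0 _); apply: val_inj.
have [||l1 [l1A l1gen]] := @generates_ge0 (H k.+1) (fun b => b 0 i0) l HB.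
- by move=> b c; rewrite !mxE.
- by split=> [|b x [Hb b0]]; [exact: lgen.1|apply: lgen.2; apply: H0].
have [||l2 [l2A l2gen]] := @generates_ge0 (H k.+1) (fun b => - b 0 i0) l HB.
- by move=> b c; rewrite !mxE opprD.
- split=> [|b x [Hb /eqP]]; first exact: lgen.1.
  by rewrite oppr_eq0 => /eqP b0; apply: lgen.2; apply: H0.
exists (l1 ++ l2); split; first by move=> p; rewrite mem_cat => /orP[/l1A|/l2A].
move=> b x Hb Ax; have [b0|b0] := leP 0 (b 0 i0).
  apply: (@generates_sub l1 _ [set b | H k.+1 b /\ 0 <= b 0 i0]) Ax => //.
  by move=> p pl; rewrite mem_cat pl.
apply: (@generates_sub l2 _ [set b | H k.+1 b /\ 0 <= - b 0 i0]) Ax => //.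
  by move=> p pl; rewrite mem_cat pl orbT.
by split => //=; rewrite oppr_ge0 ltW.
Qed.

(** Let [E] be the support of a monomial whose degree is a multiple of [b]. If a multiple of [b'] is
    the degree of a monomial in the same generators, that monomial divides a power of the first
    one. *)
Lemma int_ray_finite_type : exists r (d : 'I_r -> G), forall b b',
  (forall E : {set 'I_r},
     (exists k (e : 'I_r -> nat), (0 < k)%N /\ b *+ k = \sum_(i in E) d i *+ e i) ->
     (exists k (e : 'I_r -> nat), (0 < k)%N /\ b' *+ k = \sum_(i in E) d i *+ e i)) ->
  int_ray A_ b `<=` int_ray A_ b'.
Proof.
have [l [lA lgen]] := finitely_generated.
pose d i := (tnth (in_tuple l) i).1; pose f i := (tnth (in_tuple l) i).2.
have df i : A_ (d i) (f i) by apply: lA; apply: mem_tnth.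
exists (size l), d => b b' bb'.
have idb' := int_ray_ideal A_ b'.
apply: sub_radical; first exact: ideal_gen_ideal.
apply: smallest_sub => // x [_ [m m0 <-]] /(lgen _ _ I).
apply: smallest_sub => // _ /monomial_exp[e [be ->]].
pose E := [set i | (0 < e i)%N]%SET.
have [|k [e' [k0 b'e']]] := bb' E.
  exists m, e; split => //; rewrite be (bigID (mem E)) /= addrC big1 ?add0r //.
  by move=> i; rewrite inE lt0n negbK => /eqP->; rewrite mulr0n.
(* On [E] the exponents [e i] are at least 1, so raising to this power makes them at least
   [e' i]. *)
exists (\max_i e' i)%N; rewrite -prodrXl.
have -> : \prod_i (f i ^+ e i) ^+ (\max_j e' j) =
    (\prod_(i in E) f i ^+ e' i) *
    \prod_(i in E) f i ^+ (e i * (\max_j e' j) - e' i).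
  rewrite -big_split /= (bigID (mem E)) /= mulrC big1 ?mul1r => [|i]; last first.
    by rewrite inE lt0n negbK => /eqP->; rewrite expr1n.
  apply: eq_bigr => i; rewrite inE => ei; rewrite -exprD -exprM subnKC //.
  by apply: leq_trans (leq_pmull _ ei); apply: leq_bigmax.
apply: (idealMr (ideal_gen_ideal _)).
apply: (@hom_int_ray_gen _ _ _ _ k) => //; rewrite b'e'.
elim/big_rec2: _ => // i y c _ Ay; apply: (gradingM gradA) => //.
exact: grading_exp.
Qed.

End Monomials.

(** * Rational cones over ordered fields *)

Section Cones.
Variable n : nat.
Local Notation Q := 'rV[rat]_n.
Implicit Types (F : realFieldType) (g s : seq Q) (u v w : Q).

Definition rvec F v : 'rV[F]_n := map_mx ratr v.
Local Notation rv := (@rvec _).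

Definition dot F (x y : 'rV[F]_n) : F := \sum_i x 0 i * y 0 i.

Lemma dotDr F (x y z : 'rV[F]_n) : dot x (y + z) = dot x y + dot x z.
Proof. by rewrite -big_split; apply: eq_bigr => i _; rewrite mxE mulrDr. Qed.

Lemma dotZr F (c : F) (x y : 'rV[F]_n) : dot x (c *: y) = c * dot x y.
Proof. by rewrite mulr_sumr; apply: eq_bigr => i _; rewrite mxE mulrCA. Qed.

Lemma dotC F (x y : 'rV[F]_n) : dot x y = dot y x.
Proof. by apply: eq_bigr => i _; rewrite mulrC. Qed.

Lemma dot0r F (x : 'rV[F]_n) : dot x 0 = 0.
Proof. by rewrite -[0](scale0r (0 : 'rV[F]_n)) dotZr mul0r. Qed.

Lemma dotBr F (x y z : 'rV[F]_n) : dot x (y - z) = dot x y - dot x z.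
Proof. by rewrite dotDr -scaleN1r dotZr mulN1r. Qed.

Lemma dotBl F (x y z : 'rV[F]_n) : dot (y - z) x = dot y x - dot z x.
Proof. by rewrite !(dotC _ x) dotBr. Qed.

Lemma dotZl F (c : F) (x y : 'rV[F]_n) : dot (c *: y) x = c * dot y x.
Proof. by rewrite !(dotC _ x) dotZr. Qed.

Lemma dot_sumr F (x : 'rV[F]_n) (T : Type) (r : seq T) (P : pred T) (y : T -> 'rV[F]_n) :
  dot x (\sum_(i <- r | P i) y i) = \sum_(i <- r | P i) dot x (y i).
Proof. by apply: (big_morph (dot x)) => [z w|]; rewrite ?dotDr ?dot0r. Qed.

Lemma rvecD F v w : rvec F (v + w) = rv v + rv w.
Proof. exact: map_mxD. Qed.

Lemma rvecB F v w : rvec F (v - w) = rv v - rv w.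
Proof. exact: map_mxB. Qed.

Lemma rvec0 F : rvec F 0 = 0.
Proof. exact: map_mx0. Qed.

Lemma rvecZ F (c : rat) v : rvec F (c *: v) = ratr c *: rv v.
Proof. exact: map_mxZ. Qed.

Lemma rvec_sum F (T : Type) (r : seq T) (P : pred T) (v : T -> Q) :
  rvec F (\sum_(i <- r | P i) v i) = \sum_(i <- r | P i) rv (v i).
Proof. by apply: (big_morph (rvec F)) => [x y|]; rewrite ?rvecD ?rvec0. Qed.

Lemma ratr_id (q : rat) : ratr q = q.
Proof. by rewrite /ratr divq_num_den. Qed.

Lemma rvec_id v : rvec rat v = v.
Proof. by apply/rowP => i; rewrite mxE ratr_id. Qed.

Lemma dot_rvec F v w : dot (rvec F v) (rv w) = ratr (dot v w).
Proof. by rewrite rmorph_sum; apply: eq_bigr => i _; rewrite !mxE rmorphM. Qed.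

Lemma dot_rvecN F w (x : 'rV[F]_n) : dot (rv (- w)) x = - dot (rv w) x.
Proof. by rewrite -sub0r rvecB rvec0 dotBl dotC dot0r sub0r. Qed.

(** Peeling off one generator at a time matches the elimination of one variable in [cone_weyl]. *)
Fixpoint cone F g (x : 'rV[F]_n) : Prop :=
  if g is v :: g' then exists2 t : F, 0 <= t & cone g' (x - t *: rv v) else x = 0.

Lemma exists_seq_max F (T : eqType) (r : seq T) (f : T -> F) :
  exists t, [/\ 0 <= t, forall i, i \in r -> f i <= t
    & t = 0 \/ exists2 i, i \in r & t = f i].
Proof.
elim: r => [|i r [t [t0 ft tE]]]; first by exists 0; split => //; left.
have [fit|tfi] := leP (f i) t.
  exists t; split => //; first by move=> j; rewrite inE => /orP[/eqP->//|/ft].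
  by case: tE => [|[j jr tj]]; [left|right; exists j => //; rewrite inE jr orbT].
exists (f i); split; first exact: le_trans t0 (ltW tfi).
  by move=> j; rewrite inE => /orP[/eqP->//|/ft jt]; apply: le_trans jt (ltW tfi).
by right; exists i => //; rewrite mem_head.
Qed.

(* Fourier-Motzkin elimination; the functionals do not depend on the field. *)
Theorem cone_weyl g : exists s : seq Q, forall F (x : 'rV[F]_n),
  cone g x <-> forall w, w \in s -> 0 <= dot (rv w) x.
Proof.
elim: g => [|v g [s sP]].
  exists ([seq delta_mx 0 i | i <- enum 'I_n] ++ [seq - delta_mx 0 i | i <- enum 'I_n]).
  have dotd F i (x : 'rV[F]_n) : dot (rv (delta_mx 0 i)) x = x 0 i.
    rewrite /dot (bigD1 i) //= big1 ?addr0 => [|j ji]; rewrite !mxE ?eqxx /=.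
      by rewrite rmorph1 mul1r.
    by rewrite (negPf ji) rmorph0 mul0r.
  have dotdN F i (x : 'rV[F]_n) : dot (rv (- delta_mx 0 i)) x = - x 0 i.
    by rewrite dot_rvecN dotd.
  move=> F x; split => [-> w _|wx]; first by rewrite dot0r.
  apply/rowP => i; apply/eqP; rewrite mxE eq_le; apply/andP; split.
    rewrite -oppr_ge0 -dotdN; apply: wx; rewrite mem_cat; apply/orP; right.
    by apply/mapP; exists i; rewrite ?mem_enum.
  rewrite -dotd; apply: wx; rewrite mem_cat; apply/orP; left.
  by apply/mapP; exists i; rewrite ?mem_enum.
pose sp := [seq p <- s | 0 < dot p v]; pose sm := [seq m <- s | dot m v < 0].
(* Each pair of functionals of opposite signs at [v] gives a positive combination that vanishes at
   [v]. *)
exists ([seq w <- s | 0 <= dot w v] ++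
  [seq dot p v *: m - dot m v *: p | p <- sp, m <- sm]).
move=> F x; split.
  move=> [t t0 /sP tx] w; rewrite mem_cat => /orP[|/allpairsP[[p m] /= []]].
    rewrite mem_filter => /andP[wv /tx]; rewrite dotBr dotZr dot_rvec subr_ge0.
    by apply: le_trans; rewrite mulr_ge0 // ler0q.
  rewrite !mem_filter => /andP[pv /tx px] /andP[mv /tx mx] ->.
  move: px mx; rewrite rvecB !rvecZ dotBl !dotZl !dotBr !dotZr !dot_rvec.
  move: pv mv; rewrite -(ltr0q F) -(ltrq0 F).
  move: (ratr (dot p v) : F) (ratr (dot m v) : F) (dot (rv p) x) (dot (rv m) x).
  move=> a b c d a0 b0 H1 H2.
  have := mulr_ge0 (ltW a0) H2.
  have : 0 <= - b * (c - t * a) by rewrite mulr_ge0 // oppr_ge0 ltW.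
  by nra.
move=> wx.
(* Functionals negative at [v] bound [t] from below, positive ones from above. The largest lower
   bound, or 0, meets the upper bounds thanks to the paired functionals. *)
have [t [t0 tmax tE]] := exists_seq_max sm (fun m => dot (rv m) x / ratr (dot m v)).
exists t => //; apply/sP => w ws; rewrite dotBr dotZr dot_rvec subr_ge0.
have [wv|wv|wv] := ltgtP (dot w v) 0; last first.
- rewrite wv rmorph0 mulr0; apply: wx; rewrite mem_cat mem_filter ws.
  by rewrite wv lexx.
- have wx0 : 0 <= dot (rv w) x.
    by apply: wx; rewrite mem_cat mem_filter ws ltW.
  have wv' : 0 < ratr (dot w v) :> F by rewrite ltr0q.
  case: tE => [->|[m ms ->]]; first by rewrite mul0r.
  have mv : ratr (dot m v) < 0 :> F.
    by move: ms; rewrite mem_filter ltrq0 => /andP[].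
  have : 0 <= dot (rv (dot w v *: m - dot m v *: w)) x.
    apply: wx; rewrite mem_cat; apply/orP; right.
    by apply/allpairsP; exists (w, m); rewrite /= mem_filter wv ws ms.
  rewrite rvecB !rvecZ dotBl !dotZl subr_ge0 => H.
  by rewrite mulrAC ler_ndivrMr // mulrC [leRHS]mulrC.
- have wv' : ratr (dot w v) < 0 :> F by rewrite ltrq0.
  have := tmax w; rewrite mem_filter wv ws => /(_ isT).
  by rewrite ler_ndivrMr.
Qed.

Lemma cone0 F g : cone g (0 : 'rV[F]_n).
Proof. by have [s sP] := cone_weyl g; apply/sP => w _; rewrite dot0r. Qed.

Lemma coneD F g (x y : 'rV[F]_n) : cone g x -> cone g y -> cone g (x + y).
Proof.
have [s sP] := cone_weyl g; move=> /sP gx /sP gy; apply/sP => w ws.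
by rewrite dotDr addr_ge0 ?gx ?gy.
Qed.

Lemma coneZ F g t (x : 'rV[F]_n) : 0 <= t -> cone g x -> cone g (t *: x).
Proof.
have [s sP] := cone_weyl g; move=> t0 /sP gx; apply/sP => w ws.
by rewrite dotZr mulr_ge0 ?gx.
Qed.

Lemma cone_mem F g v : v \in g -> cone g (rvec F v).
Proof.
elim: g => // w g IHg; rewrite inE => /orP[/eqP->|/IHg gv] /=.
  by exists 1 => //; rewrite scale1r subrr; apply: cone0.
by exists 0 => //; rewrite scale0r subr0.
Qed.

Lemma cone_min F g (S : 'rV[F]_n -> Prop) : S 0 ->
  (forall x y, S x -> S y -> S (x + y)) ->
  (forall t x, 0 <= t -> S x -> S (t *: x)) ->
  (forall v, v \in g -> S (rv v)) -> forall x, cone g x -> S x.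
Proof.
move=> S0 SD SZ; elim: g => [_ x ->//|v g IHg Sg x [t t0 gx]].
rewrite -(subrK (t *: rv v) x); apply: SD; last by apply/SZ/Sg/mem_head.
by apply: IHg gx => w wg; apply: Sg; rewrite inE wg orbT.
Qed.

Lemma cone_sub F g g' : (forall v, v \in g -> cone g' (rvec F v)) ->
  forall x : 'rV[F]_n, cone g x -> cone g' x.
Proof.
by move=> gg'; apply: cone_min => //; [exact: cone0|exact: coneD|exact: coneZ].
Qed.

(** The inequalities of [cone_weyl] are the same over both fields, and [ratr] preserves signs. *)
Lemma cone_rvec F g v : cone g (rvec F v) <-> cone g v.
Proof.
have [s sP] := cone_weyl g; split => /sP gv; apply/sP => w ws; have := gv w ws.
  by rewrite dot_rvec rvec_id ler0q.
by rewrite dot_rvec rvec_id ler0q.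
Qed.

Lemma cone_rat_sub F g g' : (forall v, cone g v -> cone g' v) ->
  forall x : 'rV[F]_n, cone g x -> cone g' x.
Proof.
move=> gg'; apply: cone_sub => v vg; apply/cone_rvec/gg'.
by rewrite -[v]rvec_id; apply: cone_mem.
Qed.

Lemma cone_imageP F (T : finType) (d : T -> Q) (E : {pred T}) (x : 'rV[F]_n) :
  cone [seq d i | i in E] x <->
  exists c, (forall i, 0 <= c i) /\ x = \sum_(i in E) c i *: rv (d i).
Proof.
split.
  apply: (@cone_min _ _ (fun x => exists c : T -> F,
    (forall i, 0 <= c i) /\ x = \sum_(i in E) c i *: rv (d i))).
  - by exists (fun=> 0); split => //; rewrite big1 // => i _; rewrite scale0r.
  - move=> _ _ [c [c0 ->]] [e [e0 ->]]; exists (fun i => c i + e i); split.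
      by move=> i; rewrite addr_ge0.
    by rewrite -big_split; apply: eq_bigr => i _; rewrite scalerDl.
  - move=> t _ t0 [c [c0 ->]]; exists (fun i => t * c i); split.
      by move=> i; rewrite mulr_ge0.
    by rewrite scaler_sumr; apply: eq_bigr => i _; rewrite scalerA.
  - move=> v /mapP[i]; rewrite mem_enum => iE ->; exists (fun j => (j == i)%:R); split => //.
    rewrite (bigD1 i) //= eqxx scale1r big1 ?addr0 // => j /andP[_ /negPf->].
    by rewrite scale0r.
move=> [c [c0 ->]]; elim/big_ind: _ => [|y z|i iE]; first exact: cone0.
  exact: coneD.
by apply: coneZ => //; apply: cone_mem; apply: map_f; rewrite mem_enum.
Qed.

(** Biduality: the functionals cutting out the cone of [s] generate the wanted cone. A functional
    [w] non-negative on them lies in the cone of [s], so it is non-negative at every [x] satisfying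
    the inequalities of [s]. *)
Lemma cone_minkowski s : exists g, forall F (x : 'rV[F]_n),
  cone g x <-> forall w, w \in s -> 0 <= dot (rv w) x.
Proof.
have [g gP] := cone_weyl s; have [t tP] := cone_weyl g.
exists g => F x; split.
  move=> gx w ws; apply: (@cone_min _ _ (fun y => 0 <= dot (rv w) y)) gx => //.
  - by rewrite dot0r.
  - by move=> y z; rewrite dotDr; apply: addr_ge0.
  - by move=> a y a0 wy; rewrite dotZr mulr_ge0.
  - move=> v vg; rewrite dotC; have := cone_mem F ws.
    by move=> /gP; apply.
move=> sx; apply/tP => w wt.
have : cone s (rvec F w).
  apply/gP => v vg; rewrite dotC; have := cone_mem F vg.
  by move=> /tP; apply.
apply: (@cone_min F s (fun y => 0 <= dot y x)) => [|y z|a y a0|//].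
- by rewrite dotC dot0r.
- by rewrite !(dotC _ x) dotDr; apply: addr_ge0.
- by rewrite dotZl; apply: mulr_ge0.
Qed.

Lemma cone_bigI (T : eqType) (r : seq T) (G : T -> seq Q) :
  exists g, forall F (x : 'rV[F]_n),
    cone g x <-> forall i, i \in r -> cone (G i) x.
Proof.
elim: r => [|i r [g gP]].
  have [g gP] := cone_minkowski [::]; exists g => F x.
  by split=> [_ j //|_]; apply/gP.
have [s sP] := cone_weyl g; have [t tP] := cone_weyl (G i).
have [h hP] := cone_minkowski (t ++ s); exists h => F x; split.
  move=> /hP hx j; rewrite inE => /orP[/eqP->|jr].
    by apply/tP => w wt; apply: hx; rewrite mem_cat wt.
  by apply: (gP F x).1 jr; apply/sP => w ws; apply: hx; rewrite mem_cat ws orbT.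
move=> Gx; apply/hP => w; rewrite mem_cat => /orP[wt|ws].
  by have /tP := Gx _ (mem_head _ _); apply.
have /gP/sP : forall j, j \in r -> cone (G j) x by move=> j jr; apply: Gx; rewrite inE jr orbT.
exact.
Qed.

Lemma cone_setI g1 g2 : exists g, forall F (x : 'rV[F]_n),
  cone g x <-> cone g1 x /\ cone g2 x.
Proof.
have [g gP] := cone_bigI [:: true; false] (fun b : bool => if b then g1 else g2).
exists g => F x; rewrite gP; split=> [H|[H1 H2] [] //].
by split; [apply: (H true)|apply: (H false)].
Qed.

End Cones.

Lemma common_denominator (T : finType) (c : T -> rat) :
  exists2 k, (0 < k)%N & exists z : T -> int, forall i, k%:R * c i = (z i)%:~R.
Proof.
exists (\prod_i `|denq (c i)|)%N.
  by apply: prodn_gt0 => i; rewrite absz_gt0 denq_neq0.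
exists (fun i => numq (c i) * (\prod_(j | j != i) `|denq (c j)|)%N) => i.
rewrite (bigD1 i) //= natrM intrM mulrAC; congr (_ * _).
by rewrite natr_absz normr_denq numqE mulrC.
Qed.

(** * Ray ideals of rational vectors *)

Section RationalRays.
Variables (R : realType) (n : nat) (A : idomainType) (A_ : 'rV[int]_n -> set A).
Hypotheses (gradA : is_grading A_) (noethA : noetherian A).
Hypothesis fieldA0 : is_field_subring (A_ 0).
Local Notation G := 'rV[int]_n.
Local Notation Q := 'rV[rat]_n.
Local Notation J := (ray_ideal R A_).
Implicit Types (a b c : Q) (x y : A).

Let A01 : A_ 0 1 := fieldA0.1.

Definition qint (b : G) : Q := map_mx intr b.

Lemma qintD (b c : G) : qint (b + c) = qint b + qint c.
Proof. exact: map_mxD. Qed.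

Lemma qintB (b c : G) : qint (b - c) = qint b - qint c.
Proof. exact: map_mxB. Qed.

Lemma qint_inj : injective qint.
Proof.
move=> b c /rowP bc; apply/rowP => i; apply: (@intr_inj rat).
by have := bc i; rewrite !mxE.
Qed.

Lemma qintMn (b : G) k : qint (b *+ k) = k%:R *: qint b.
Proof. by rewrite scaler_nat; apply: (raddfMn (map_mx intr)). Qed.

Lemma intv_qint (b : G) : intv R b = ratv R (qint b).
Proof. by apply/rowP => i; rewrite !mxE ratr_int. Qed.

Lemma ratv_inj : injective (@ratv R n).
Proof. exact: map_mx_inj. Qed.

Lemma ratvZ (t : rat) a : ratv R (t *: a) = ratr t *: ratv R a.
Proof. exact: rvecZ. Qed.

Lemma ratvB a b : ratv R (a - b) = ratv R a - ratv R b.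
Proof. exact: rvecB. Qed.

Lemma exists_qint a : exists k (b : G), (0 < k)%N /\ qint b = k%:R *: a.
Proof.
have [k k0 [z zP]] := common_denominator (fun i => a 0 i).
by exists k, (\row_i z i); split => //; apply/rowP => i; rewrite !mxE zP.
Qed.

Lemma exists_qint2 a b : exists k (a' b' : G),
  [/\ (0 < k)%N, qint a' = k%:R *: a & qint b' = k%:R *: b].
Proof.
have [k [a' [k0 aE]]] := exists_qint a; have [l [b' [l0 bE]]] := exists_qint b.
exists (k * l)%N, (a' *+ l), (b' *+ k); split; first by rewrite muln_gt0 k0.
  by rewrite qintMn aE scalerA -natrM mulnC.
by rewrite qintMn bE scalerA -natrM.
Qed.

(** A non-zero coordinate of [a] shows that the real factor [r] is rational; its numerator and
    denominator yield [p] and [q]. *)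
Lemma real_ray_int a k (b b' : G) (r : R) : (0 < k)%N -> qint b = k%:R *: a ->
  0 < r -> intv R b' = r *: ratv R a ->
  exists p q, [/\ (0 < p)%N, (0 < q)%N & b' *+ q = b *+ p].
Proof.
move=> k0 bE r0 b'E.
have [a0|na] := pselect (forall i, a 0 i = 0).
  have {}a0 : a = 0 by apply/rowP => i; rewrite mxE.
  exists 1%N, 1%N; split => //; congr (_ *+ _); apply: qint_inj.
  rewrite bE a0 scaler0; apply: ratv_inj.
  by rewrite -intv_qint b'E a0 [ratv R 0]rvec0 scaler0.
have [i ai] : exists i, a 0 i != 0.
  apply: contrapT => ai; apply: na => i; apply: contrapT => /eqP ai0.
  by apply: ai; exists i.
pose t : rat := qint b' 0 i / a 0 i.
have tr : ratr t = r.
  have := congr1 (fun v : 'rV[R]_n => v 0 i) b'E; rewrite intv_qint !mxE => H.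
  by rewrite rmorphM fmorphV /= mxE H mulfK // fmorph_eq0.
have t0 : 0 < t by rewrite -(ltr0q R) tr.
have b'ta : qint b' = t *: a by apply: ratv_inj; rewrite -intv_qint b'E ratvZ tr.
pose s := t / k%:R; have s0 : 0 < s by rewrite divr_gt0 ?ltr0n.
have b's : qint b' = s *: qint b by rewrite b'ta bE scalerA divfK // pnatr_eq0 -lt0n.
exists `|numq s|%N, `|denq s|%N; split; rewrite ?absz_gt0 ?denq_neq0 //.
  by rewrite numq_eq0 gt_eqF.
apply: qint_inj; rewrite !qintMn b's scalerA !natr_absz normr_denq.
by rewrite ger0_norm ?numq_ge0 ?ltW // numqE mulrC.
Qed.

Lemma ray_idealE a k (b : G) : (0 < k)%N -> qint b = k%:R *: a ->
  J a = int_ray A_ b.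
Proof.
move=> k0 bE; apply/seteqP; split.
  apply: sub_radical; first exact: ideal_gen_ideal.
  apply: smallest_sub; first exact: int_ray_ideal.
  move=> x [b' [r r0 b'E] Ax].
  have [p [q [p0 q0 pq]]] := real_ray_int k0 bE r0 b'E.
  apply: (@radical_exp_inv _ _ _ q); apply: (@hom_int_ray _ _ _ _ p) => //.
  by rewrite -pq; apply: grading_exp.
apply: sub_radical; first exact: ideal_gen_ideal.
apply: subset_trans (@radical_sub _ _); apply: sub_smallest2r.
  exact: ideal_gen_ideal.
move=> x [_ [m m0 <-] Ax]; exists (b *+ m) => //; exists (m * k)%:R.
  by rewrite ltr0n muln_gt0 m0.
by rewrite intv_qint qintMn bE scalerA -natrM ratvZ ratr_nat.
Qed.

Lemma ray_is_ideal a : is_ideal (J a).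
Proof. exact/radical_ideal/ideal_gen_ideal. Qed.

Lemma ray_neq0 a b : J a `<=` J b -> J a <> [set 0] -> J b <> [set 0].
Proof.
move=> ab a0 b0; apply: a0; apply/seteqP; split; first by rewrite -b0.
by move=> _ ->; have [] := ray_is_ideal a.
Qed.

Lemma rayZ t a : 0 < t -> J (t *: a) = J a.
Proof.
move=> t0; rewrite /ray_ideal /ray_gen_ideal.
have t0' : 0 < ratr t :> R by rewrite ltr0q.
congr (radical (ideal_gen (bigcup _ _))); apply/seteqP; split => b [r r0 bE].
  by exists (r * ratr t); [rewrite mulr_gt0|rewrite bE ratvZ scalerA].
exists (r / ratr t); first by rewrite divr_gt0.
by rewrite bE ratvZ scalerA divfK // gt_eqF.
Qed.

Lemma rayD a b x : J a x -> J b x -> J (a + b) x.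
Proof.
have [k [a' [b' [k0 aE bE]]]] := exists_qint2 a b.
have abE : qint (a' + b') = k%:R *: (a + b) by rewrite qintD aE bE scalerDr.
rewrite (ray_idealE k0 aE) (ray_idealE k0 bE) (ray_idealE k0 abE).
exact: int_rayD.
Qed.

Lemma ray0 : J 0 = setT.
Proof.
have E0 : qint 0 = 1%:R *: 0 by rewrite scaler0; apply: map_mx0.
rewrite (ray_idealE _ E0) //; apply/seteqP; split => // x _; exact: int_ray0.
Qed.

Lemma rayD_sub a b c : J a <> [set 0] -> J a `<=` J b -> J a `<=` J c ->
  J (b + c) `<=` J b.
Proof.
have [k [a' [k0 aE]]] := exists_qint a.
have [l [b' [c' [l0 bE cE]]]] := exists_qint2 b c.
have bcE : qint (b' + c') = l%:R *: (b + c) by rewrite qintD bE cE scalerDr.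
rewrite (ray_idealE k0 aE) (ray_idealE l0 bE) (ray_idealE l0 bcE).
by rewrite (ray_idealE l0 cE); apply: int_ray_add_sub.
Qed.

Lemma ray_sub_opp a b : J a `<=` J b ->
  exists2 N : rat, 0 < N & J a `<=` J (N *: a - b).
Proof.
have [k [a' [b' [k0 aE bE]]]] := exists_qint2 a b.
rewrite (ray_idealE k0 aE) (ray_idealE k0 bE) => ab.
have [N N0 aN] := int_ray_sub_opp gradA noethA A01 ab.
exists N%:R; first by rewrite ltr0n.
have E : qint (a' *+ N - b') = k%:R *: (N%:R *: a - b).
  by rewrite qintB qintMn aE bE scalerBr !scalerA mulrC.
by rewrite (ray_idealE k0 E).
Qed.

Lemma ray_finite_type : exists r (d : 'I_r -> Q), forall b b',
  (forall E : {set 'I_r}, cone [seq d i | i in E] b -> cone [seq d i | i in E] b') ->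
  J b `<=` J b'.
Proof.
have [r [d dP]] := int_ray_finite_type gradA noethA A01.
exists r, (fun i => qint (d i)) => b b' bb'.
have [k [c [c' [k0 cE cE']]]] := exists_qint2 b b'.
have k0' : 0 < k%:R :> rat by rewrite ltr0n.
rewrite (ray_idealE k0 cE) (ray_idealE k0 cE'); apply: dP => E.
move=> [l [e [l0 ce]]].
have /bb'/cone_imageP[f [f0 b'E]] : cone [seq qint (d i) | i in E] b.
  apply/cone_imageP; exists (fun i => (e i)%:R / (l%:R * k%:R)); split.
    by move=> i; rewrite divr_ge0.
  have : qint (c *+ l) = \sum_(i in E) (e i)%:R *: qint (d i).
    rewrite ce; have -> : qint (\sum_(i in E) d i *+ e i) = \sum_(i in E) qint (d i *+ e i).
      exact: (raddf_sum (map_mx intr)).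
    by apply: eq_bigr => i _; rewrite qintMn.
  rewrite qintMn cE scalerA => H.
  transitivity ((l%:R * k%:R)^-1 *: (l%:R * k%:R *: b)).
    by rewrite scalerA mulVf ?scale1r // mulf_neq0 // pnatr_eq0 -lt0n.
  rewrite H scaler_sumr; apply: eq_bigr => i _.
  by rewrite scalerA rvec_id mulrC.
have [m m0 [z zE]] := common_denominator f.
exists m, (fun i => k * `|z i|)%N; split => //; apply: qint_inj.
have -> : qint (\sum_(i in E) d i *+ (k * `|z i|)) =
    \sum_(i in E) qint (d i *+ (k * `|z i|)) by exact: (raddf_sum (map_mx intr)).
rewrite qintMn cE' b'E scalerA scaler_sumr; apply: eq_bigr => i _.
rewrite rvec_id qintMn scalerA natrM mulrAC zE mulrC natr_absz ger0_norm //.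
by rewrite -(ler0z rat) -zE mulr_ge0.
Qed.

(** Write 1 as a combination of elements [h i] of one degree on the ray, with homogeneous
    coefficients. Some [t i * h i] is non-zero in the field [A_ 0], so [h i] is a unit, hence also
    of degree 0; being non-zero, it has only one degree. *)
Lemma ray_setT a : [set x | A_ 0 x /\ x <> 0] = [set x | x \is a GRing.unit] ->
  J a = setT -> a = 0.
Proof.
move=> unitA JT; have [k [b [k0 bE]]] := exists_qint a.
have : int_ray A_ b 1 by rewrite -(ray_idealE k0 bE) JT.
have [K K0 /(_ 1%N isT)KP] := int_ray_exact gradA noethA A01 b.
move=> /KP[j]; rewrite expr1n muln1 => b1.
have [m [d [h [dh hgen]]]] := hom_noetherian gradA [set b *+ K] noethA.
have [|t At E1] := hgen _ _ A01; first by rewrite bigcup_set1.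
have [i thi] : exists i, t i * h i != 0.
  apply: contrapT => th0; have /eqP := oner_neq0 A; apply.
  rewrite E1 big1 // => i _; have [//|thi] := eqVneq (t i * h i) 0.
  by case: th0; exists i.
have Ath : A_ 0 (t i * h i).
  by rewrite -(subrK (d i) 0); apply: (gradingM gradA) => //; have [] := dh i.
have [y _ thy] := fieldA0.2 _ Ath (elimN eqP thi).
have : [set x | x \is a GRing.unit] (h i).
  by apply/unitrPr; exists (t i * y); rewrite mulrA (mulrC (h i)).
rewrite -unitA => -[Ah0 hi0]; have [di Ahi] := dh i.
have bK0 : b *+ K = 0.
  apply: contrapT => /eqP bK; apply: hi0.
  by apply: (grading_eq0 gradA bK) => //; rewrite -di.
have : qint (b *+ K) = 0 by rewrite bK0; apply: map_mx0.
rewrite qintMn bE scalerA -natrM => /eqP; rewrite scaler_eq0 pnatr_eq0 muln_eq0.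
by rewrite !gtn_eqF //= => /eqP.
Qed.

End RationalRays.

(** * Cones in the real vector space *)

Section RealCones.
Variables (R : realType) (n : nat).
Local Notation V := 'rV[R]_n.
Local Notation Q := 'rV[rat]_n.
Local Notation rat_point := (@ratv R n).
Implicit Types (s t : set V) (x y z : V) (g : seq Q) (a b c v w : Q).

Definition rcone g : set V := fun x => cone g x.

Lemma rcone_ratv g v : rcone g (rat_point v) <-> cone g v.
Proof. exact: cone_rvec. Qed.

Lemma rational_polyhedralP s : rational_polyhedral s <-> exists g, s = rcone g.
Proof.
split=> [[m [g ->]]|[g ->]].
  exists [seq g i | i in 'I_m]; apply/seteqP; split => x.
    by move=> [c [c0 ->]]; apply/cone_imageP; exists c.
  by move=> /cone_imageP[c [c0 ->]]; exists c.
exists (size g), (tnth (in_tuple g)); apply/seteqP.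
have gE v : (v \in g) = (v \in [seq tnth (in_tuple g) i | i in 'I_(size g)]).
  rewrite -[g in LHS]/(val (in_tuple g)).
  by apply/tnthP/mapP => [[i ->]|[i _ ->]]; exists i; rewrite ?mem_enum.
split => x.
  move=> gx; suff /cone_imageP[c [c0 ->]] :
      cone [seq tnth (in_tuple g) i | i in 'I_(size g)] x by exists c.
  by apply: cone_sub gx => v vg; apply: cone_mem; rewrite -gE.
move=> [c [c0 ->]]; have : cone [seq tnth (in_tuple g) i | i in 'I_(size g)]
    (\sum_i c i *: rat_point (tnth (in_tuple g) i)).
  by apply/cone_imageP; exists c.
by apply: cone_sub => v; rewrite -gE => vg; apply: cone_mem.
Qed.

Lemma rcone_is_cone g : is_cone (rcone g).
Proof. by split=> [x y|t x]; [exact: coneD|exact: coneZ]. Qed.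

Lemma rcone_min g (S : V -> Prop) : S 0 ->
  (forall x y, S x -> S y -> S (x + y)) ->
  (forall (r : R) x, 0 <= r -> S x -> S (r *: x)) ->
  (forall v, v \in g -> S (rat_point v)) -> forall x, rcone g x -> S x.
Proof. exact: cone_min. Qed.

Lemma is_cone0 s x : is_cone s -> s x -> s 0.
Proof. by move=> [_ sZ] /(sZ 0 x (lexx 0)); rewrite scale0r. Qed.

Lemma is_cone_diffset s : is_cone s ->
  [/\ forall x y, diffset s x -> diffset s y -> diffset s (x + y),
      forall (r : R) x, diffset s x -> diffset s (r *: x)
    & s `<=` diffset s].
Proof.
move=> cs; have [sD sZ] := cs; split.
- move=> _ _ [x sx [y sy <-]] [z sz [w sw <-]]; exists (x + z); first exact: sD.
  by exists (y + w); [exact: sD|rewrite opprD addrACA].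
- move=> t _ [x sx [y sy <-]]; have [t0|t0] := leP 0 t.
    exists (t *: x); first exact: sZ.
    by exists (t *: y); [exact: sZ|rewrite scalerBr].
  have t0' : 0 <= - t by rewrite oppr_ge0 ltW.
  exists (- t *: y); first exact: sZ.
  exists (- t *: x); first exact: sZ.
  by rewrite !scaleNr opprK addrC -scalerBr.
- by move=> x sx; exists x => //; exists 0; [exact: is_cone0 sx|rewrite subr0].
Qed.

Lemma rcone_rational_span g : rational_span (diffset (rcone g)).
Proof.
have cg := rcone_is_cone g; have [gD gZ gsub] := is_cone_diffset cg.
exists g; apply/seteqP; split => x.
  have gspan : forall y, rcone g y -> y \in <<map rat_point g>>%VS.
    apply: rcone_min.
    - exact: mem0v.
    - by move=> u v; exact: memvD.
    - by move=> t u _; exact: memvZ.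
    - by move=> v vg; apply: memv_span; apply: map_f.
  by move=> [y gy [z gz <-]]; rewrite /= memvB ?gspan.
move=> /= /(@coord_span _ _ _ (in_tuple (map rat_point g)))->.
elim/big_ind: _ => [|u v|i _]; first by apply: gsub; exact: cone0.
  exact: gD.
apply: gZ; apply: gsub.
have /mapP[v vg ->] : (map rat_point g)`_i \in map rat_point g by exact: mem_nth.
exact: cone_mem.
Qed.

Lemma relintP s x : relint s x <->
  s x /\ exists2 e : R, 0 < e & forall y, `|x - y| < e -> diffset s y -> s y.
Proof.
have nearE : (\forall y \near within (diffset s) (nbhs x), s y) =
    (\forall y \near x, diffset s y -> s y) by rewrite near_withinE.
rewrite /relint /mkset nearE; split=> -[sx].
  by move=> /nbhs_normP[e e0 es]; split => //; exists e.
by move=> [e e0 es]; split => //; apply/nbhs_normP; exists e.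
Qed.

Lemma relint_open s x : relint s x -> exists2 e : R, 0 < e &
  forall y, `|x - y| < e -> diffset s y -> relint s y.
Proof.
move=> /relintP[sx [e e0 es]]; exists (e / 2); first by rewrite divr_gt0.
move=> y xy sy; apply/relintP; split.
  by apply: es => //; apply: lt_trans xy _; rewrite ltr_pdivrMr // ltr_pMr // ltr1n.
exists (e / 2); first by rewrite divr_gt0.
move=> z yz sz; apply: es => //; rewrite -(subrK y x) -addrA.
by apply: le_lt_trans (ler_normD _ _) _; rewrite [ltRHS]splitr ltrD.
Qed.

Lemma relintD s x y : is_cone s -> relint s x -> s y -> relint s (x + y).
Proof.
move=> cs /relintP[sx [e e0 es]] sy; have [sD sZ] := cs.
have [dD dZ dsub] := is_cone_diffset cs.
apply/relintP; split; first exact: sD.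
exists e => // z xyz dz; rewrite -(subrK y z); apply: (sD) => //; apply: es.
  by rewrite opprB addrA.
by apply: dD => //; rewrite -scaleN1r; apply: dZ; apply: dsub.
Qed.

Lemma small_rat (e : R) : 0 < e -> exists2 q : rat, 0 < q & ratr q < e.
Proof.
move=> /rat_in_itvoo[q]; rewrite in_itv /= ltr0q => /andP[q0 qe].
by exists q.
Qed.

Lemma relint_sub s x y : is_cone s -> relint s x -> s y ->
  exists2 e : rat, 0 < e & s (x - ratr e *: y).
Proof.
move=> cs /relintP[sx [e e0 es]] sy; have [dD dZ dsub] := is_cone_diffset cs.
have y0 : 0 < `|y| + 1 by rewrite ltr_wpDl.
have [|q q0 qe] := @small_rat (e / (`|y| + 1)); first by rewrite divr_gt0.
exists q => //; apply: es.
  rewrite opprB addrC subrK normrZ gtr0_norm ?ltr0q //.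
  move: qe; rewrite ltr_pdivlMr //; apply: le_lt_trans.
  by apply: ler_wpM2l; [rewrite ler0q ltW|rewrite lerDl].
by apply: dD; [exact: dsub|rewrite -scaleNr; apply/dZ/dsub].
Qed.

Lemma dot_norm_le x y : `|dot x y| <= (\sum_i `|x 0 i|) * `|y|.
Proof.
rewrite mulr_suml; apply: le_trans (ler_norm_sum _ _ _) _.
apply: ler_sum => i _; rewrite normrM ler_wpM2l //.
rewrite [leRHS]/Num.Def.normr /= mx_normrE.
exact: (le_bigmax 0 (fun ij : 'I_1 * 'I_n => `|y ij.1 ij.2|) (0, i)).
Qed.

Lemma dot_gt0_near x y : 0 < dot x y -> exists2 e : R, 0 < e &
  forall z, `|y - z| < e -> 0 < dot x z.
Proof.
move=> xy; pose K := \sum_i `|x 0 i| + 1.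
have K0 : 0 < K by rewrite ltr_wpDl // sumr_ge0.
exists (dot x y / K); first by rewrite divr_gt0.
move=> z; rewrite ltr_pdivlMr // => yz.
have : dot x y - dot x z < dot x y.
  rewrite -dotBr; apply: le_lt_trans yz; apply: le_trans (ler_norm _) _.
  apply: le_trans (dot_norm_le _ _) _; rewrite mulrC ler_wpM2l //.
  by rewrite lerDl.
by rewrite gtrBl.
Qed.

(** A functional of [cone_weyl] is either positive at the sum, hence nearby, or zero at every
    generator, hence on the whole span. This supplies a rational point in the relative interior. *)
Lemma relint_rcone_sum g : relint (rcone g) (rat_point (\sum_(v <- g) v)).
Proof.
have [s sP] := cone_weyl g; set c := \sum_(v <- g) v.
have gc : rcone g (rat_point c).
  apply/rcone_ratv; rewrite /c big_seq; elim/big_ind: _ => [|u v|v vg].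
  - exact: cone0.
  - exact: coneD.
  - by rewrite -[v]rvec_id; apply: cone_mem.
apply/relintP; split => //.
suff [e e0 es] : exists2 e : R, 0 < e & forall w y, w \in s ->
    `|rat_point c - y| < e -> diffset (rcone g) y -> 0 <= dot (rvec R w) y.
  by exists e => // y cy dy; apply/sP => w ws; apply: es.
have sg w v : w \in s -> v \in g -> 0 <= dot w v.
  move=> ws vg; have /sP/(_ w ws) : cone g (rvec rat v) by apply: cone_mem.
  by rewrite !rvec_id.
clear sP gc; elim: s sg => [|w s IHs] sg; first by exists 1.
have [|e e0 es] := IHs; first by move=> u v us; apply: sg; rewrite inE us orbT.
suff [e' e'0 ew] : exists2 e' : R, 0 < e' & forall y,
    `|rat_point c - y| < e' -> diffset (rcone g) y -> 0 <= dot (rvec R w) y.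
  exists (Num.min e e'); first by rewrite lt_min e0.
  move=> u y; rewrite inE lt_min => /orP[/eqP->|us] /andP[ye ye'] dy; first exact: ew.
  exact: es.
have wg v : v \in g -> 0 <= dot w v by apply: sg; rewrite mem_head.
have [wc|wc] := ltP 0 (dot w c).
  have [|e' e'0 ew] := @dot_gt0_near (rvec R w) (rat_point c).
    by rewrite dot_rvec ltr0q.
  by exists e' => // y /ew/ltW.
have w0 v : v \in g -> dot w v = 0.
  have : dot w c = 0.
    by apply/le_anti; rewrite wc /= dot_sumr big_seq sumr_ge0.
  rewrite dot_sumr big_seq => /eqP; rewrite psumr_eq0 // => /allP w0 vg.
  by have := w0 _ vg; rewrite vg => /eqP.
exists 1 => // y _ [y1 gy1 [y2 gy2 <-]].
suff H z : rcone g z -> dot (rvec R w) z = 0 by rewrite dotBr !H // subrr.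
apply: (@rcone_min g (fun z => dot (rvec R w) z = 0)).
- exact: dot0r.
- by move=> u v; rewrite dotDr => -> ->; rewrite addr0.
- by move=> t u _; rewrite dotZr => ->; rewrite mulr0.
- by move=> v vg; rewrite dot_rvec w0 // rmorph0.
Qed.

Lemma rat_point_dense g x (e : R) : x \in <<map rat_point g>>%VS -> 0 < e ->
  exists2 b, rat_point b \in <<map rat_point g>>%VS & `|x - rat_point b| < e.
Proof.
move=> /(@coord_span _ _ _ (in_tuple (map rat_point g)))->.
move: e; elim/big_ind: _ => [e e0|u v IHu IHv e e0|i _ e e0].
- by exists 0; rewrite [ratv R 0]rvec0 ?mem0v // subrr normr0.
- have e2 : 0 < e / 2 by rewrite divr_gt0.
  have [b bg ub] := IHu _ e2; have [c cg vc] := IHv _ e2.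
  exists (b + c); rewrite [ratv R _]rvecD; first exact: memvD.
  rewrite opprD addrACA; apply: le_lt_trans (ler_normD _ _) _.
  by rewrite [ltRHS]splitr ltrD.
have /mapP[v vg ->] : (map rat_point g)`_i \in map rat_point g by exact: mem_nth.
move: (coord _ _ _) => t.
have v0 : 0 < `|rat_point v| + 1 by rewrite ltr_wpDl.
have [|q] := @rat_in_itvoo R (t - e / (`|rat_point v| + 1)) t.
  by rewrite gtrBl divr_gt0.
rewrite in_itv /= => /andP[qt tq]; exists (q *: v).
  by rewrite [ratv R _]rvecZ memvZ // memv_span // map_f.
rewrite [ratv R (_ *: _)]rvecZ -scalerBl normrZ gtr0_norm ?subr_gt0 //.
move: qt; rewrite ltrBlDr -ltrBlDl ltr_pdivlMr //; apply: le_lt_trans.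
by rewrite ler_wpM2l ?lerDl // subr_ge0 ltW.
Qed.

Lemma relint_rat_halfspace s x y w : is_cone s -> rational_span (diffset s) ->
  relint s x -> s y -> dot (rvec R w) y < 0 ->
  exists2 b, relint s (rat_point b) & dot (rvec R w) (rat_point b) < 0.
Proof.
move=> cs [g dE] sx sy wy; have [dD dZ dsub] := is_cone_diffset cs.
have [sD sZ] := cs.
(* Moving by [M *: y] brings the functional [w] down to at most -1 and stays in the relative
   interior; a rational approximation then keeps both properties. *)
pose M := (`|dot (rvec R w) x| + 1) / - dot (rvec R w) y.
have M0 : 0 <= M by rewrite divr_ge0 ?addr_ge0 // oppr_ge0 ltW.
pose p := x + M *: y.
have wp : 0 < dot (rvec R (- w)) p.
  rewrite dot_rvecN dotDr dotZr.
  have -> : M * dot (rvec R w) y = - (`|dot (rvec R w) x| + 1).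
    by rewrite /M invrN mulrN mulNr divfK // lt_eqF.
  by have := ler_norm (dot (rvec R w) x); lra.
have sp : relint s p by apply: relintD => //; exact: sZ.
have [e1 e10 es] := relint_open sp; have [e2 e20 ew] := dot_gt0_near wp.
have [||b bg pb] := @rat_point_dense g p (Num.min e1 e2).
- by have := dsub p sp.1; rewrite dE.
- by rewrite lt_min e10.
move: pb; rewrite lt_min => /andP[pb1 pb2]; exists b.
  by apply: es => //; rewrite dE.
by have := ew _ pb2; rewrite dot_rvecN oppr_gt0.
Qed.

(** The functional [u] may be irrational, but only the generators on which it vanishes matter:
    non-negative terms with sum zero all vanish. *)
Lemma face_rcone g t : is_face t (rcone g) -> exists h, t = rcone h.
Proof.
move=> [u [u0 ->]].
have ug v : v \in g -> 0 <= u (rat_point v) by move=> vg; apply: u0; apply: cone_mem.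
exists [seq v <- g | u (rat_point v) == 0]; apply/seteqP; split; last first.
  move=> x hx; split.
    apply: cone_sub hx => v; rewrite mem_filter => /andP[_ vg]; exact: cone_mem.
  apply: (@rcone_min _ (fun z => u z = 0)) hx.
  - exact: linear0.
  - by move=> y z; rewrite linearD => -> ->; rewrite addr0.
  - by move=> c y _; rewrite linearZ /= => ->; rewrite mulr0.
  - by move=> v; rewrite mem_filter => /andP[/eqP].
clear u0; move=> x []; elim: g ug x => [//|v g IHg] ug x [c c0 gx] ux.
have ug' w : w \in g -> 0 <= u (rat_point w).
  by move=> wg; apply: ug; rewrite inE wg orbT.
have u1 : 0 <= u (x - c *: rvec R v).
  apply: (@rcone_min _ (fun z => 0 <= u z)) gx.
  - by rewrite linear0.
  - by move=> y z; rewrite linearD; apply: addr_ge0.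
  - by move=> e y e0; rewrite linearZ; apply: mulr_ge0.
  - by move=> w /ug'.
have u2 : 0 <= u (c *: rvec R v).
  by rewrite linearZ; apply: mulr_ge0 => //; apply: ug; rewrite mem_head.
have : u (x - c *: rvec R v) + u (c *: rvec R v) == 0 by rewrite -linearD subrK ux.
rewrite paddr_eq0 // => /andP[/eqP u1E /eqP u2E].
have {}IHg := IHg ug' _ gx u1E; rewrite /rcone /=.
case: ifP => [_|uv]; first by exists c.
suff -> : x = x - c *: rvec R v by [].
move: u2E; rewrite linearZ => /eqP; rewrite mulf_eq0 [_ == 0 as X in _ || X]uv orbF => /eqP->.
by rewrite scale0r subr0.
Qed.

(** The face is cut out by the sum [W] of the functionals of [cone_weyl] that vanish at [c]. Points
    of the face annihilate each of these; the others are positive at [c] and leave room for a small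
    step. *)
Lemma minimal_face g c : cone g c -> exists t,
  [/\ is_face t (rcone g), t (rat_point c) &
      forall b, t (rat_point b) -> exists2 e : rat, 0 < e & t (rat_point (c - e *: b))].
Proof.
have [s sP] := cone_weyl g; move=> gc.
have sg b w : cone g b -> w \in s -> 0 <= dot w b.
  by move=> /sP gb ws; have := gb w ws; rewrite rvec_id.
pose W := \sum_(w <- s | dot w c == 0) w.
have Wlin : scalar (dot (rvec R W)) by move=> a x y; rewrite dotDr dotZr.
pose uM := GRing.isLinear.Build _ _ _ _ (dot (rvec R W)) Wlin.
pose u : {scalar V} := HB.pack (dot (rvec R W)) uM.
have uE x : u x = \sum_(w <- s | dot w c == 0) dot (rvec R w) x.
  rewrite -[u x]/(dot (rvec R W) x) dotC /W rvec_sum dot_sumr.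
  by apply: eq_bigr => w _; rewrite dotC.
have u0 x : rcone g x -> 0 <= u x.
  by move=> /sP gx; rewrite uE big_seq_cond sumr_ge0 // => w /andP[/gx].
exists [set x | rcone g x /\ u x = 0]; split; first by exists u.
  split; first exact/rcone_ratv.
  by rewrite uE big1 // => w /eqP wc; rewrite dot_rvec wc rmorph0.
move=> b [/rcone_ratv gb ub].
have wb w : w \in s -> dot w c = 0 -> dot w b = 0.
  move=> ws wc; move: ub; rewrite uE => /eqP.
  rewrite big_seq_cond psumr_eq0 => [|v /andP[vs _]]; last first.
    by rewrite dot_rvec ler0q; apply: sg.
  move=> /allP/(_ _ ws); rewrite ws wc eqxx /= dot_rvec fmorph_eq0.
  by move=> /eqP.
(* Where [dot w c = 0] the quotient is 0 by convention and harmless; [wb] covers that case. *)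
have [t [t0 tmax _]] := exists_seq_max s (fun w => dot w b / dot w c).
have e0 : 0 < (t + 1)^-1 by rewrite invr_gt0 ltr_wpDl.
exists (t + 1)^-1 => //; split.
  apply/rcone_ratv/sP => w ws; rewrite rvec_id dotBr dotZr subr_ge0.
  have [wc|wc] := eqVneq (dot w c) 0; first by rewrite wb // mulr0 wc.
  have {}wc : 0 < dot w c by rewrite lt_neqAle eq_sym wc sg.
  rewrite mulrC ler_pdivrMr ?ltr_wpDl //.
  have := tmax w ws; rewrite ler_pdivrMr // mulrC => H; apply: le_trans H _.
  by rewrite ler_wpM2l ?lerDl // ltW.
rewrite uE big_seq_cond big1 // => w /andP[ws /eqP wc].
by rewrite dot_rvec dotBr dotZr wc wb // mulr0 subrr rmorph0.
Qed.

(** The direction [d] may be irrational, but it lies in the cone defined by the inequalities and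
    their opposites, which has rational generators, one of them non-zero. *)
Lemma rcone_line g : contains_line (rcone g) ->
  exists v, [/\ v <> 0, cone g v & cone g (- v)].
Proof.
move=> [p [d [d0 pd]]]; have [s sP] := cone_weyl g.
have sd w : w \in s -> dot (rvec R w) d = 0.
  move=> ws; apply/eqP; apply: contrapT => /negP wd.
  (* At this parameter the functional [w] would take the value -1. *)
  have /sP/(_ w ws) := pd ((- dot (rvec R w) p - 1) / dot (rvec R w) d).
  by rewrite dotDr dotZr divfK //; lra.
have [h hP] := cone_minkowski (s ++ [seq - w | w <- s]).
have hd : cone h d.
  apply/hP => w; rewrite mem_cat => /orP[/sd->//|/mapP[v /sd vd ->]].
  by rewrite dot_rvecN vd oppr0.
have [v vh v0] : exists2 v, v \in h & v <> 0.
  apply: contrapT => h0; apply: d0.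
  apply: (@rcone_min h (fun x => x = 0)) hd => //.
  - by move=> x y -> ->; rewrite addr0.
  - by move=> t x _ ->; rewrite scaler0.
  - move=> v vh; have [->|/eqP v0] := eqVneq v 0; first exact: rvec0.
    by case: h0; exists v.
have /hP hv : cone h v by rewrite -[v]rvec_id; exact: cone_mem.
exists v; split => //; apply/sP => w ws; have := hv w.
  by rewrite mem_cat ws; apply.
move=> _; rewrite -[- v]sub0r dotBr dot0r sub0r -dot_rvecN; apply: hv.
by rewrite mem_cat map_f ?orbT.
Qed.

End RealCones.

(** * The fan of maximal ray ideal cones *)

Section Fan.
Variables (R : realType) (n : nat) (A : idomainType) (A_ : 'rV[int]_n -> set A).
Hypotheses (gradA : is_grading A_) (noethA : noetherian A).
Hypothesis fieldA0 : is_field_subring (A_ 0).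
Local Notation Q := 'rV[rat]_n.
Local Notation J := (ray_ideal R A_).
Local Notation rat_point := (@ratv R n).
Local Notation rcone := (@rcone R n).
Implicit Types (a b c : Q) (g h : seq Q) (s t : set 'rV[R]_n).

(* Names the cone sigma_J of [J = J a] by rational generators. *)
Definition spans_above a g := forall b, cone g b <-> J a `<=` J b.

(* [J b] depends only on the set of the cones spanned by degrees of generators
   that contain [b]; the intersection of these closed cones lies above [b]. *)
Lemma ray_type : exists (T : finType) (tp : Q -> T),
  (forall a b, tp a = tp b -> J a = J b) /\
  forall i, exists g, forall a, tp a = i ->
    cone g a /\ forall b, cone g b -> J a `<=` J b.
Proof.
have [r [d dP]] := ray_finite_type R gradA noethA fieldA0.
pose tp b := [set E : {set 'I_r} | `[< cone [seq d i | i in E] b >]]%SET.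
exists {set {set 'I_r}}, tp; split.
  move=> a b ab; apply/seteqP; split; apply: dP => E aE.
    by have : E \in tp a by [rewrite inE; apply/asboolP]; rewrite ab inE => /asboolP.
  by have : E \in tp b by [rewrite inE; apply/asboolP]; rewrite -ab inE => /asboolP.
move=> W; have [g gP] := cone_bigI (enum W) (fun E => [seq d i | i in E]).
exists g => a aW; split.
  by apply/gP => E; rewrite mem_enum -aW inE => /asboolP.
move=> b /gP gb; apply: dP => E aE; apply: gb.
by rewrite mem_enum -aW inE; apply/asboolP.
Qed.

Lemma finite_ray_ideals : finite_set [set K | nonzero_ray_ideal R A_ K].
Proof.
have [T [tp [tpP _]]] := ray_type.
pose f i : set A := [set x | exists2 a, tp a = i & J a x].
apply: (@sub_finite_set _ _ (f @` setT)); last exact: finite_image.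
move=> _ [[a ->] _]; exists (tp a) => //; apply/seteqP; split => x.
  by move=> [b /tpP <-].
by exists a.
Qed.

(** The points above [a] form a convex cone that is a union of finitely many cones [G i], one for
    each type occurring among them, so all their generators together span it. *)
Lemma exists_spans_above a : exists g, spans_above a g.
Proof.
have [T [tp [_ /choice[G GP]]]] := ray_type.
pose P i := `[< exists2 b, tp b = i & J a `<=` J b >].
exists (flatten [seq G i | i <- enum T & P i]) => b; split.
  apply: (@cone_min n rat _ (fun b => J a `<=` J b)).
  - by rewrite ray0.
  - by move=> c c' ac ac' x ax; apply: rayD => //; [exact: ac|exact: ac'].
  - move=> r c; rewrite le_eqVlt => /orP[/eqP<-|r0] ac.
      by rewrite scale0r ray0.
    by rewrite rayZ.
  - move=> v /flatten_mapP[i]; rewrite mem_filter => /andP[/asboolP[c ci ac] _] vi.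
    rewrite rvec_id; apply: (subset_trans ac); apply: (GP i c ci).2.
    by rewrite -[v]rvec_id; apply: cone_mem.
move=> ab; have [Gb _] := GP (tp b) b erefl.
apply: cone_sub Gb => v vG.
apply: cone_mem; apply/flatten_mapP; exists (tp b) => //.
by rewrite mem_filter mem_enum andbT; apply/asboolP; exists b.
Qed.

(** A relative interior point splits as [b = e *: c + (b - e *: c)] inside [s], and fact (i) applies
    to the two summands. *)
Lemma relint_ray_eq s a b : is_cone s ->
  (forall c, s (rat_point c) -> J a `<=` J c) -> J a <> [set 0] ->
  relint s (rat_point b) -> forall c, s (rat_point c) -> J b `<=` J c.
Proof.
move=> cs sa a0 sb c sc; have [e e0 sbec] := relint_sub cs sb sc.
have sec : s (rat_point (e *: c)).
  by rewrite ratvZ; apply: cs.2 => //; rewrite ler0q ltW.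
have -> : b = e *: c + (b - e *: c) by rewrite addrC subrK.
rewrite -(rayZ R A_ c e0); apply: (rayD_sub gradA noethA fieldA0 a0); apply: sa => //.
by rewrite ratvB ratvZ.
Qed.

Lemma rcone_ray_ideal_cone g a b : J b <> [set 0] -> rcone g (rat_point a) ->
  (forall c, cone g c -> J b `<=` J c) -> ray_ideal_cone A_ (rcone g).
Proof.
move=> b0 ga gb; have cg := rcone_is_cone R g.
have gb' c : rcone g (rat_point c) -> J b `<=` J c by move=> /rcone_ratv/gb.
split => //; first exact: rcone_rational_span.
move=> c c' gc gc'; split; last first.
  by apply: ray_neq0 b0; apply: gb'; case: gc.
apply/seteqP; split; first by apply: relint_ray_eq gb' b0 gc _ _ => //; case: gc'.
by apply: relint_ray_eq gb' b0 gc' _ _ => //; case: gc.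
Qed.

Lemma spans_above_self a g : spans_above a g -> cone g a.
Proof. by move=> /(_ a)[_]; apply. Qed.

Lemma spans_above_relint a g : spans_above a g -> J a <> [set 0] ->
  forall b, relint (rcone g) (rat_point b) -> J a = J b.
Proof.
move=> ag a0 b gb; apply/seteqP; split.
  by apply/ag/(@rcone_ratv R); case: gb.
apply: (relint_ray_eq (rcone_is_cone R g) _ a0 gb).
  by move=> c /rcone_ratv/ag.
exact/rcone_ratv/spans_above_self.
Qed.

Lemma spans_above_cone_of a g : spans_above a g -> J a <> [set 0] ->
  ray_ideal_cone_of A_ (J a) (rcone g).
Proof.
move=> ag a0; split.
  apply: (rcone_ray_ideal_cone (a := a) a0); first exact/rcone_ratv/spans_above_self.
  by move=> c /ag.
exists (\sum_(v <- g) v); first exact: relint_rcone_sum.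
exact: spans_above_relint ag a0 _ (relint_rcone_sum R g).
Qed.

(** A point of [t] outside [rcone g] violates a rational inequality, and then so does a rational
    point [c] of the relative interior of [t]. But [J c = J a] puts [c] in [rcone g]. *)
Lemma ray_ideal_cone_sub a g t : spans_above a g ->
  ray_ideal_cone_of A_ (J a) t -> t `<=` rcone g.
Proof.
move=> ag [[ct dt tJ] [b tb ab]] x tx; have [s sP] := cone_weyl g.
apply/sP => w ws; rewrite leNgt; apply/negP => wx.
have [c tc] := relint_rat_halfspace ct dt tb tx wx.
apply/negP; rewrite -leNgt; have /sP/(_ w ws) : rcone g (rat_point c) by
  apply/rcone_ratv/ag; rewrite ab (tJ _ _ tb tc).1.
exact.
Qed.

Lemma maximal_spans_above a g : spans_above a g -> J a <> [set 0] ->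
  maximal_ray_ideal_cone A_ (J a) (rcone g).
Proof.
move=> ag a0; split; first exact: spans_above_cone_of.
move=> t /(ray_ideal_cone_sub ag) tg gt; exact/seteqP.
Qed.

Lemma maximal_unique a g s : spans_above a g -> J a <> [set 0] ->
  maximal_ray_ideal_cone A_ (J a) s -> s = rcone g.
Proof.
move=> ag a0 [sJ smax]; apply/esym/smax; first exact: spans_above_cone_of.
exact: ray_ideal_cone_sub sJ.
Qed.

(** Since [s] lies in the maximal cone of its ray ideal [J a], that ideal is below the ray ideals of
    all rational points of the face, which is all [rcone_ray_ideal_cone] asks for. *)
Lemma face_ray_ideal_cone s t : rational_polyhedral s -> ray_ideal_cone A_ s ->
  is_face t s -> ray_ideal_cone A_ t.
Proof.
move=> /rational_polyhedralP[g ->] gJ tg.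
pose a := \sum_(v <- g) v; have ga : relint (rcone g) (rat_point a).
  exact: relint_rcone_sum.
have [h ah] := exists_spans_above a; have [_ _ /(_ a a ga ga)[_ a0]] := gJ.
have gh : rcone g `<=` rcone h.
  by apply: ray_ideal_cone_sub ah _; split => //; exists a.
have [k tk] := face_rcone tg; rewrite tk.
apply: (@rcone_ray_ideal_cone k 0 a) => //; first by rewrite [ratv R _]rvec0; exact: cone0.
move=> c /(@rcone_ratv R) kc; apply/ah/(@rcone_ratv R)/gh.
by have [u [_ tE]] := tg; move: kc; rewrite -tk tE => -[].
Qed.

(* A face of the maximal cone of [J a] is the maximal cone of [J c] for any [c]
   in its relative interior: if [J c `<=` J b], then [N c - b] and [b] both lie
   in the maximal cone of [J a], hence in the face. *)
Lemma face_spans_above a g t c : spans_above a g -> J a <> [set 0] ->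
  is_face t (rcone g) -> t (rat_point c) ->
  (forall b, t (rat_point b) ->
     exists2 e : rat, 0 < e & t (rat_point (c - e *: b))) ->
  exists2 h, spans_above c h & t = rcone h.
Proof.
move=> ag a0 tg tc tce; have [h th] := face_rcone tg; exists h => //.
have [u [u0 tE]] := tg.
have ta b : t (rat_point b) -> J a `<=` J b.
  by rewrite tE => -[/rcone_ratv/ag].
move=> b; split.
  move=> /(@rcone_ratv R); rewrite -th => tb; have [e e0 tceb] := tce b tb.
  have -> : c = e *: b + (c - e *: b) by rewrite addrC subrK.
  rewrite -(rayZ R A_ b e0); apply: (rayD_sub gradA noethA fieldA0 a0).
    by rewrite rayZ //; apply: ta.
  exact: ta.
move=> cb; have [N N0 cN] := ray_sub_opp gradA noethA fieldA0 cb.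
have ac := ta _ tc.
have gb : rcone g (rat_point b) by apply/rcone_ratv/ag; apply: subset_trans cb.
have gN : rcone g (rat_point (N *: c - b)).
  by apply/rcone_ratv/ag; apply: subset_trans cN.
apply/(@rcone_ratv R); rewrite -th tE; split => //; apply/le_anti.
(* As [u] vanishes at [c], its value at [N *: c - b] is the opposite of its value at [b]; both are
   non-negative. *)
have := u0 _ gN; rewrite ratvB ratvZ linearB linearZ /=.
have uc : u (ratv R c) = 0 by move: tc; rewrite tE => -[].
by rewrite uc mulr0 sub0r oppr_ge0 => ->; rewrite u0.
Qed.

(** The minimal face containing [a1] is itself the maximal cone of [J a1]. *)
Lemma ray_sub_face a1 a2 g1 g2 : spans_above a1 g1 -> spans_above a2 g2 ->
  J a2 <> [set 0] -> J a2 `<=` J a1 -> is_face (rcone g1) (rcone g2).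
Proof.
move=> ag1 ag2 a20 a21; have [t [tg ta tae]] := @minimal_face R _ _ _ ((ag2 a1).2 a21).
have [h ah th] := face_spans_above ag2 a20 tg ta tae.
suff -> : rcone g1 = t by [].
rewrite th; apply/seteqP; split => x; apply: cone_rat_sub => v.
  by move=> /ag1/ah.
by move=> /ah/ag1.
Qed.

End Fan.

Theorem theorem6p2 (R : realType) (n : nat) (A : idomainType)
    (A_ : 'rV[int]_n -> set A)
    (gradA : is_grading A_)
    (noethA : noetherian A)
    (fieldA0 : is_field_subring (A_ 0)) :
  [/\ (* (1) *)
      finite_set [set J | nonzero_ray_ideal R A_ J],
      (* (2) *)
      forall J, nonzero_ray_ideal R A_ J ->
        (exists! s : set 'rV[R]_n, maximal_ray_ideal_cone A_ J s) /\
        forall s : set 'rV[R]_n, maximal_ray_ideal_cone A_ J s ->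
          rational_polyhedral s /\
          forall a : 'rV[rat]_n, ~ s (ratv R a) -> ray_ideal R A_ a <> J,
      (* (3) *)
      forall s t : set 'rV[R]_n,
        rational_polyhedral s -> ray_ideal_cone A_ s -> is_face t s ->
        ray_ideal_cone A_ t,
      (* (4) *)
      forall (J1 J2 : set A) (s1 s2 : set 'rV[R]_n),
        nonzero_ray_ideal R A_ J1 -> nonzero_ray_ideal R A_ J2 ->
        maximal_ray_ideal_cone A_ J1 s1 -> maximal_ray_ideal_cone A_ J2 s2 ->
        (J2 `<=` J1 <-> is_face s1 s2)
    & (* (5) *)
      [set x | A_ 0 x /\ x <> 0] = [set x | x \is a GRing.unit] ->
      is_fan [set s : set 'rV[R]_n | exists2 J, nonzero_ray_ideal R A_ J &
                                       maximal_ray_ideal_cone A_ J s]].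
Proof.
have above := exists_spans_above R gradA noethA fieldA0.
have uniq := @maximal_unique R _ _ _ gradA noethA fieldA0.
split.
- exact: finite_ray_ideals.
- move=> _ [[a ->] a0]; have [g ag] := above a; split.
    exists (rcone g); split; first exact: maximal_spans_above.
    by move=> s /(uniq _ _ _ ag a0).
  move=> s /(uniq _ _ _ ag a0) ->; split; first by apply/rational_polyhedralP; exists g.
  by move=> b gb ba; apply: gb; apply/rcone_ratv/ag; rewrite ba.
- exact: face_ray_ideal_cone.
- move=> _ _ s1 s2 [[a1 ->] a10] [[a2 ->] a20].
  have [g1 ag1] := above a1; have [g2 ag2] := above a2.
  move=> /(uniq _ _ _ ag1 a10) -> /(uniq _ _ _ ag2 a20) ->; split.
    exact: ray_sub_face.
  move=> [u [_ g12]]; apply/ag2/(@rcone_ratv R).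
  have : rcone g1 (ratv R a1) by apply/rcone_ratv; exact: spans_above_self ag1.
  by rewrite g12 => -[].
move=> unitA.
have fanP (s : set 'rV[R]_n) : (exists2 J, nonzero_ray_ideal R A_ J & maximal_ray_ideal_cone A_ J s) <->
    exists a g, [/\ ray_ideal R A_ a <> [set 0], spans_above R A_ a g & s = rcone g].
  split=> [[_ [[a ->] a0] sJ]|[a [g [a0 ag ->]]]].
    by have [g ag] := above a; exists a, g; split => //; exact: uniq _ _ _ ag a0 sJ.
  exists (ray_ideal R A_ a); first by split => //; exists a.
  exact: maximal_spans_above.
split.
- move=> s /fanP[a [g [a0 ag ->]]]; split; first by apply/rational_polyhedralP; exists g.
  (* Fact (i) applied to [v] and [- v] bounds [J v] below by [J 0], the whole ring. *)
  move=> /rcone_line[v [v0 /ag av /ag avN]]; apply: v0.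
  apply: (ray_setT gradA noethA fieldA0 unitA (R := R)).
  apply/seteqP; split => // x _.
  by apply: (rayD_sub gradA noethA fieldA0 a0 av avN); rewrite subrr ray0 //; exact: fieldA0.1.
- move=> _ t /fanP[a [g [a0 ag ->]]] tg; have [k tk] := face_rcone tg.
  have kc := relint_rcone_sum R k; set c := \sum_(v <- k) v in kc.
  have [||h ch th] := @face_spans_above R n A A_ gradA noethA fieldA0 a g t c ag a0 tg.
  + by rewrite tk; case: kc.
  + move=> b tb; rewrite tk in tb.
    have [e e0 ke] := relint_sub (rcone_is_cone R k) kc tb.
    by exists e => //; rewrite tk ratvB ratvZ.
  apply/fanP; exists c, h; split => //; apply: ray_neq0 a0.
  apply/ag/(@rcone_ratv R); have [u [_ tE]] := tg.
  by have : t (ratv R c) by [rewrite tk; case: kc]; rewrite tE => -[].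
- move=> _ _ /fanP[a1 [g1 [a10 ag1 ->]]] /fanP[a2 [g2 [a20 ag2 ->]]].
  have [k kP] := cone_setI g1 g2.
  have kE : rcone g1 `&` rcone g2 = rcone k :> set 'rV[R]_n.
    by apply/seteqP; split => x; [move=> ?; apply/kP|move=> /kP].
  have kc := relint_rcone_sum R k; set c := \sum_(v <- k) v in kc.
  have [g1c g2c] : cone g1 c /\ cone g2 c.
    by apply/kP; apply/(@rcone_ratv R); case: kc.
  (* The intersection is again a cone of the family, that of the ray ideal of a relative interior
     point [c]; part (4) then makes it a face of both. *)
  have ck : spans_above R A_ c k.
    move=> b; split=> [|cb].
      move=> /(@rcone_ratv R); apply: (relint_ray_eq gradA noethA fieldA0 _ _ a10 kc).
        exact: rcone_is_cone.
      by move=> d /rcone_ratv/kP[/ag1].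
    by apply/kP; split; [apply/ag1/(subset_trans _ cb)/ag1|apply/ag2/(subset_trans _ cb)/ag2].
  rewrite kE; split.
    by apply: (ray_sub_face gradA noethA fieldA0 ck ag1 a10); apply/ag1.
  by apply: (ray_sub_face gradA noethA fieldA0 ck ag2 a20); apply/ag2.
Qed.
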